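(* Let $T_0$ be any (seed) triangulation of a convex $(n+3)$-gon and let $\alpha_1,\dots,\alpha_n$ be a basis of an $n$-dimensional real vector space $V$. The simplicial cones $\mathbb R_{\ge0}T$ generated by all triangulations $T$ of the $(n+3)$-gon form (together with their faces) a complete simplicial fan $\mathcal F_{T_0}$ in the ambient space $V$.
   Context: A diagonal of a convex polygon means an internal diagonal; two diagonals cross if they meet in a point interior to both. A triangulation of a convex $(n+3)$-gon (without new vertices) is identified with its set of $n$ pairwise non-crossing diagonals. Write $T_0=\{\delta_1,\dots,\delta_n\}$. To each of the $n(n+3)/2$ diagonals $pq$ of the $(n+3)$-gon associate a vector $v_{pq}\in V$: if $pq=\delta_i$ for some $i$, then $v_{pq}=-\alpha_i$; if $pq\notin T_0$, then $v_{pq}=\sum_{i:\ pq\text{ crosses }\delta_i}\alpha_i$. For a triangulation $T$, $\mathbb R_{\ge0}T$ denotes the cone generated by the vectors $\{v_\delta:\delta\in T\}$. *)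

(* Defs.v *)
From HB Require Import structures.
From mathcomp Require Import all_boot all_order all_algebra.
From mathcomp Require Import all_classical all_reals.

Set Implicit Arguments.
Unset Strict Implicit.
Unset Printing Implicit Defensive.

Import Order.TTheory GRing.Theory Num.Theory.
Local Open Scope classical_set_scope.
Local Open Scope ring_scope.

(* Twice the signed area of the triangle a b c. *)
Definition orientation (R : realType) (a b c : 'rV[R]_2) : R :=
  (b 0 0 - a 0 0) * (c 0 1 - a 0 1) - (b 0 1 - a 0 1) * (c 0 0 - a 0 0).

(* P lists the vertices of a convex m-gon in one of its two cyclic orders
   (clockwise or counterclockwise): for each side, the other vertices all lie
   strictly on the same side of the line through it.  Taking k = l shows that
   no other vertex lies on that line, so for 3 <= m the vertices are
   distinct. *)
Definition convex_polygon (R : realType) (m : nat) (P : 'I_m -> 'rV[R]_2) :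
    Prop :=
  forall i k l : 'I_m,
    k != i -> k != ordS i -> l != i -> l != ordS i ->
    0 < orientation (P i) (P (ordS i)) (P k) *
        orientation (P i) (P (ordS i)) (P l).

(* The unordered pair {p, q} of non-adjacent vertices is represented by the
   pair (p, q) with p < q. *)
Definition is_diagonal (m : nat) (d : 'I_m * 'I_m) : bool :=
  [&& (d.1 < d.2)%N, d.2 != ordS d.1 & d.1 != ordS d.2].

Definition polygon_diagonal (m : nat) := {d : 'I_m * 'I_m | is_diagonal d}.

Definition open_segment (R : realType) (a b : 'rV[R]_2) : set 'rV[R]_2 :=
  [set (1 - t) *: a + t *: b | t in [set t : R | 0 < t < 1]].

Definition diagonal_interior (R : realType) (m : nat) (P : 'I_m -> 'rV[R]_2)
    (d : polygon_diagonal m) : set 'rV[R]_2 :=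
  open_segment (P (val d).1) (P (val d).2).

(* Meant for two distinct diagonals. *)
Definition cross (R : realType) (m : nat) (P : 'I_m -> 'rV[R]_2)
    (d e : polygon_diagonal m) : Prop :=
  diagonal_interior P d `&` diagonal_interior P e !=set0.

Definition triangulation (R : realType) (n : nat) (P : 'I_n.+3 -> 'rV[R]_2)
    (T : {set polygon_diagonal n.+3}) : Prop :=
  #|T| = n /\
  forall d e : polygon_diagonal n.+3,
    d \in T -> e \in T -> d != e -> ~ cross P d e.

Definition diagonal_vector (R : realType) (n : nat) (P : 'I_n.+3 -> 'rV[R]_2)
    (V : vectType R) (delta : n.-tuple (polygon_diagonal n.+3))
    (alpha : n.-tuple V) (d : polygon_diagonal n.+3) : V :=
  if [pick i : 'I_n | tnth delta i == d] is Some i then - tnth alpha i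
  else \sum_(i < n | `[< cross P d (tnth delta i) >]) tnth alpha i.

Definition cone (R : realType) (V : vectType R) (s : seq V) : set V :=
  [set x | exists2 c : nat -> R, forall i, 0 <= c i
           & x = \sum_(i < size s) c i *: s`_i].

Definition simplicial_cone (R : realType) (V : vectType R) (C : set V) :
    Prop :=
  exists2 s : seq V, free s & C = cone s.

(* The zero functional is allowed, so C is a face of itself. *)
Definition face (R : realType) (V : vectType R) (C F : set V) : Prop :=
  exists2 f : {scalar V}, forall x, C x -> 0 <= f x
  & F = C `&` [set x | f x = 0].

Definition simplicial_fan (R : realType) (V : vectType R) (F : set (set V)) :
    Prop :=
  [/\ finite_set F,
      forall C, F C -> simplicial_cone C,
      forall C D, F C -> face C D -> F D
    & forall C D, F C -> F D -> face C (C `&` D) /\ face D (C `&` D)].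

Definition complete_fan (R : realType) (V : vectType R) (F : set (set V)) :
    Prop :=
  \bigcup_(C in F) C = setT.

Definition triangulation_generators (R : realType) (n : nat)
    (P : 'I_n.+3 -> 'rV[R]_2) (V : vectType R)
    (delta : n.-tuple (polygon_diagonal n.+3)) (alpha : n.-tuple V)
    (T : {set polygon_diagonal n.+3}) : seq V :=
  [seq diagonal_vector P delta alpha d | d <- enum T].

Definition triangulation_cone (R : realType) (n : nat)
    (P : 'I_n.+3 -> 'rV[R]_2) (V : vectType R)
    (delta : n.-tuple (polygon_diagonal n.+3)) (alpha : n.-tuple V)
    (T : {set polygon_diagonal n.+3}) : set V :=
  cone (triangulation_generators P delta alpha T).

Definition triangulation_fan (R : realType) (n : nat)
    (P : 'I_n.+3 -> 'rV[R]_2) (V : vectType R)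
    (delta : n.-tuple (polygon_diagonal n.+3)) (alpha : n.-tuple V) :
    set (set V) :=
  [set F | exists2 T : {set polygon_diagonal n.+3}, triangulation P T
           & face (triangulation_cone P delta alpha T) F].

(* Main.v *)
Require Import Defs.
From HB Require Import structures.
From mathcomp Require Import all_boot all_order all_algebra.
From mathcomp Require Import all_classical all_reals.
From mathcomp Require Import zify ring lra.

Set Implicit Arguments.
Unset Strict Implicit.
Unset Printing Implicit Defensive.

Import Order.TTheory GRing.Theory Num.Theory.
Local Open Scope classical_set_scope.
Local Open Scope ring_scope.

(* Give the diagonals nonnegative weights [c] whose support is non-crossing. The
   coordinate on [alpha_i] of [\sum_d c d *: v_d] is the total weight crossing
   [delta_i] minus the weight of [delta_i] itself, and at most one of these two
   numbers is nonzero. The theorem amounts to the bijectivity of the map from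
   non-crossing weights to vectors: injectivity makes the cones simplicial and
   intersect along common faces, surjectivity makes the fan complete.

   Bijectivity is proved by recursion on the dissection of the polygon by [T0].
   In a triangle [a < t < b] of [T0], the total weights [p], [q], [w] crossing its
   three sides determine how much weight cuts each corner and how much ends at
   each vertex. The diagonals crossing a side, listed by their end points on one
   side of it, occur in the opposite order on the other side, so how the weight
   arriving from the two sides of an edge is matched up is a matrix with given
   row and column sums and no two nonzero entries in increasing position; there
   is exactly one such matrix. The existence part at the same time constructs the
   weight crossing [(a, b)], hence the recursion goes on. *)

(** * Matrices without increasing pairs of nonzero entries *)

Section Staircase.
Variable R : realFieldType.
Implicit Types (M : nat -> nat -> R) (r c : nat -> R).

(** Nonzero entries move weakly to lower columns as the row index grows. Nonnegative matrices of
    this kind are the antimonotone couplings of their row and column sums. *)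
Definition staircase k l M := forall i1 i2 j1 j2,
  (i1 < i2 < k)%N -> (j1 < j2 < l)%N -> M i1 j1 = 0 \/ M i2 j2 = 0.

Lemma sumr_ord_neq0 k (P : pred nat) (f : nat -> R) :
  \sum_(i < k | P i) f i != 0 -> exists i, [/\ (i < k)%N, P i & f i != 0].
Proof.
move=> nz; case: (boolP [exists i : 'I_k, P i && (f i != 0)]).
  by case/existsP=> i /andP[Pi fi]; exists i.
rewrite negb_exists => /forallP h; case/negP: nz; apply/eqP.
by apply: big1 => i Pi; have := h i; rewrite Pi negbK => /eqP.
Qed.

(* The last row exhausts the sums of the lowest columns first. *)
Lemma staircase_last_row k l M j0 : (j0 <= l)%N ->
  (forall i j, (i < k.+1)%N -> (j < l)%N -> 0 <= M i j) -> staircase k.+1 l M ->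
  \sum_(j < j0) M k j =
  Num.min (\sum_(j < l) M k j) (\sum_(j < j0) \sum_(i < k.+1) M i j).
Proof.
move=> j0l M0 stM.
have le1 : \sum_(j < j0) M k j <= \sum_(j < l) M k j.
  rewrite (big_ord_widen l (fun j => M k j)) // big_mkcond /=.
  apply: ler_sum => j _; case: ifP => // _; exact: M0.
have le2 : \sum_(j < j0) M k j <= \sum_(j < j0) \sum_(i < k.+1) M i j.
  apply: ler_sum => j _; rewrite big_ord_recr /= lerDr.
  by apply: sumr_ge0 => i _; apply: M0; have := ltn_ord j; have := ltn_ord i; lia.
have [eq1|ne1] := eqVneq (\sum_(j < j0) M k j) (\sum_(j < l) M k j).
  by rewrite -eq1 min_l.
(* If the last row is not exhausted before column [j0], it has a nonzero entry at some [j2 >= j0],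
   and this entry forces the columns below [j0] to vanish above the last row. *)
have [j2 [j2l j0j2 Mj2]] : exists j, [/\ (j < l)%N, (j0 <= j)%N & M k j != 0].
  apply: (@sumr_ord_neq0 l (fun j => j0 <= j)%N); apply: contra_neq ne1 => z.
  rewrite [RHS](bigID (fun j : 'I_l => (j0 <= j)%N)) /= z add0r.
  rewrite (big_ord_widen l (fun j => M k j)) //.
  by apply: eq_bigl => j; rewrite ltnNge.
have eq2 : \sum_(j < j0) \sum_(i < k.+1) M i j = \sum_(j < j0) M k j.
  apply: eq_bigr => j _; rewrite big_ord_recr /= big1 ?add0r // => i _.
  have ji := ltn_ord j; have ik := ltn_ord i.
  by case: (stM i k j j2) => [||//|z]; [lia|lia|rewrite z eqxx in Mj2].
by rewrite eq2 min_r.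
Qed.

(** By [staircase_last_row] the partial sums of the last row depend only on the row and column sums.
    So the last row is determined; it is then removed and the induction goes on. *)
Lemma staircase_unique k l M M' :
  (forall i j, (i < k)%N -> (j < l)%N -> 0 <= M i j) ->
  (forall i j, (i < k)%N -> (j < l)%N -> 0 <= M' i j) ->
  staircase k l M -> staircase k l M' ->
  (forall i, (i < k)%N -> \sum_(j < l) M i j = \sum_(j < l) M' i j) ->
  (forall j, (j < l)%N -> \sum_(i < k) M i j = \sum_(i < k) M' i j) ->
  forall i j, (i < k)%N -> (j < l)%N -> M i j = M' i j.
Proof.
elim: k => [//|k IHk] M0 M'0 stM stM' rows cols.
have cum j0 : (j0 <= l)%N -> \sum_(j < j0) M k j = \sum_(j < j0) M' k j.
  move=> j0l; rewrite (staircase_last_row j0l M0 stM).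
  rewrite (staircase_last_row j0l M'0 stM') rows //; congr Num.min.
  by apply: eq_bigr => j _; apply: cols; apply: leq_trans j0l.
have last j : (j < l)%N -> M k j = M' k j.
  move=> jl; have := cum j.+1 jl; rewrite !big_ord_recr /= cum; last by lia.
  by move/addrI.
move=> i j; rewrite ltnS leq_eqVlt => /orP[/eqP -> jl|ik jl]; first exact: last.
apply: IHk => //.
- by move=> i' j' *; apply: M0 => //; lia.
- by move=> i' j' *; apply: M'0 => //; lia.
- by move=> i1 i2 j1 j2 *; apply: stM => //; lia.
- by move=> i1 i2 j1 j2 *; apply: stM' => //; lia.
- by move=> i' *; apply: rows; lia.
- move=> j' j'l; have := cols j' j'l.
  by rewrite !big_ord_recr /= last // => /addIr.
Qed.

(** The last row is filled greedily from the lowest column on, and the remaining rows are obtained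
    by induction from what is left of the column sums. *)
Lemma staircase_exists k l r c :
  (forall i, (i < k)%N -> 0 <= r i) -> (forall j, (j < l)%N -> 0 <= c j) ->
  \sum_(i < k) r i = \sum_(j < l) c j ->
  exists M, [/\ forall i j, (i < k)%N -> (j < l)%N -> 0 <= M i j,
    staircase k l M,
    forall i, (i < k)%N -> \sum_(j < l) M i j = r i
    & forall j, (j < l)%N -> \sum_(i < k) M i j = c j].
Proof.
elim: k c => [|k IHk] c r0 c0.
  rewrite big_ord0 => /esym/eqP; rewrite psumr_eq0; last first.
    by move=> j _; apply: c0.
  move=> /allP z; exists (fun _ _ => 0); split => [//|||j jl].
- by move=> i1 i2 j1 j2; lia.
- by [].
- by rewrite big_ord0; apply/esym/eqP/(z (Ordinal jl)); rewrite mem_index_enum.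
rewrite big_ord_recr /= => tot.
pose C j := \sum_(j' < j) c j'.
have CS j : C j.+1 = C j + c j by rewrite /C big_ord_recr.
have Cmono j1 j2 : (j1 <= j2)%N -> (j2 <= l)%N -> C j1 <= C j2.
  move=> j12 j2l; rewrite /C (big_ord_widen j2 (fun j => c j)) // big_mkcond /=.
  apply: ler_sum => j _; case: ifP => // _; apply: c0.
  by have := ltn_ord j; lia.
(* The partial sums of [lastr] are [Num.min (C j) (r k)], the only value that [staircase_last_row]
   permits. *)
pose lastr j := Num.min (C j.+1) (r k) - Num.min (C j) (r k).
have lastr0 j : (j < l)%N -> 0 <= lastr j <= c j.
  move=> jl; have := CS j; have := c0 j jl; rewrite /lastr.
  by case: (lerP (C j.+1)); case: (lerP (C j)); lra.
have sum_last : \sum_(j < l) lastr j = r k.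
  have tel j : \sum_(j' < j) lastr j' = Num.min (C j) (r k) - Num.min (C 0%N) (r k).
    elim: j => [|j IH]; first by rewrite big_ord0 subrr.
    by rewrite big_ord_recr /= IH /lastr; lra.
  rewrite tel {2}/C big_ord0 (min_l (r0 k _)) // subr0.
  rewrite min_r // /C -tot lerDr.
  by apply: sumr_ge0 => i _; apply: r0; have := ltn_ord i; lia.
have [|||M [M0 stM rowM colM]] := IHk (fun j => c j - lastr j).
- by move=> i ik; apply: r0; lia.
- by move=> j jl; have := lastr0 j jl; lra.
- by rewrite sumrB sum_last -tot addrK.
exists (fun i j => if i == k then lastr j else M i j); split.
- move=> i j; case: eqVneq => [_ _ /lastr0|ne ik jl]; first by lra.
  by apply: M0 => //; lia.
- move=> i1 i2 j1 j2 hi hj; case: (eqVneq i1 k) => [|ne1]; first by lia.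
  case: (eqVneq i2 k) => [e2|ne2]; last by apply: stM => //; lia.
  have [z|nz] := eqVneq (M i1 j1) 0; [by left|right].
  have cM : M i1 j1 <= \sum_(i < k) M i j1.
    have i1k : (i1 < k)%N by lia.
    rewrite (bigD1 (Ordinal i1k)) //= lerDl.
    by apply: sumr_ge0 => i _; apply: M0; have := ltn_ord i; lia.
  have M1 : 0 <= M i1 j1 by apply: M0; lia.
  have e := colM j1 ltac:(lia).
  have : C j1.+1 <= C j2 by apply: Cmono; lia.
  have : C j2 <= C j2.+1 by apply: Cmono; lia.
  have := CS j1; have : 0 < M i1 j1 by rewrite lt_neqAle eq_sym nz.
  (* A nonzero entry above the last row in column [j1] means that the last row has not filled this
     column. So the last row is used up there and vanishes in all later columns. *)
  have rC : 0 < M i1 j1 -> r k <= C j1.+1.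
    have := CS j1; have := c0 j1 ltac:(lia); move: e cM; rewrite /lastr.
    by case: (lerP (C j1.+1)); case: (lerP (C j1)); lra.
  move=> /rC rC1 _ le2 le1; rewrite /lastr !min_r ?subrr //; lra.
- move=> i; case: eqVneq => [->|ne] ik; first exact: sum_last.
  by rewrite rowM //; lia.
- move=> j jl; rewrite big_ord_recr /= eqxx.
  rewrite (eq_bigr (fun i : 'I_k => M i j)) ?colM // ?subrK // => i _.
  by rewrite ltn_eqF.
Qed.

End Staircase.

(** * Weights on the chords of a polygon with vertices [0, ..., m - 1] *)

Section Lamination.
Variables (R : realFieldType) (m : nat).
Implicit Types s : nat -> nat -> R.

(** A discrete measured lamination: weights on pairwise non-crossing chords. [lam_side] concerns the
    sides from [p] to [p.+1] only; the closing side from [0] to [m - 1] is not forced to have weight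
    [0]. *)
Record lamination s : Prop := Lamination {
  lam_sym : forall p q, s p q = s q p;
  lam_ge0 : forall p q, 0 <= s p q;
  lam_side : forall p, s p p.+1 = 0;
  lam_noncross : forall p p' q q', (p < p' < q)%N -> (q < q' < m)%N ->
    s p q != 0 -> s p' q' != 0 -> False }.

Definition into s a b v := \sum_(u < m | (a < u < b)%N) s v u.
Definition out s a b v := \sum_(u < m | (u < a)%N || (b < u)%N) s v u.
Definition crossing s a b := \sum_(v < m | (a < v < b)%N) out s a b v.
(** The compatibility degree with [(a, b)], with the convention that a chord has degree [-1] with
    itself; such numbers are the entries of denominator vectors in type A. *)
Definition dcoord s a b := crossing s a b - s a b.

Lemma sum_split (f : nat -> R) a t b : (a < t < b)%N -> (b < m)%N ->
  \sum_(v < m | (a < v < b)%N) f v =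
  \sum_(v < m | (a < v < t)%N) f v + f t + \sum_(v < m | (t < v < b)%N) f v.
Proof.
move=> atb bm; have tm : (t < m)%N by lia.
rewrite (bigD1 (Ordinal tm)) //= (bigID (fun v : 'I_m => (v < t)%N)) /=.
rewrite [RHS]addrAC [RHS]addrC; congr (_ + (_ + _)); apply: eq_bigl => v;
  by rewrite -val_eqE /=; lia.
Qed.

Lemma out_left s a t b v : (a < t < b)%N -> (b < m)%N ->
  out s a t v = into s t b v + s v b + out s a b v.
Proof.
move=> atb bm.
rewrite /out (bigID (fun u : 'I_m => (t < u <= b)%N)) /=; congr (_ + _).
  rewrite (bigD1 (Ordinal bm)) /=; last by lia.
  rewrite addrC; congr (_ + _); apply: eq_bigl => v'; rewrite -val_eqE /=; lia.
by apply: eq_bigl => v'; lia.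
Qed.

Lemma out_right s a t b v : (a < t < b)%N -> (b < m)%N ->
  out s t b v = into s a t v + s v a + out s a b v.
Proof.
move=> atb bm; have am : (a < m)%N by lia.
rewrite /out (bigID (fun u : 'I_m => (a <= u < t)%N)) /=; congr (_ + _).
  rewrite (bigD1 (Ordinal am)) /=; last by lia.
  rewrite addrC; congr (_ + _); apply: eq_bigl => v'; rewrite -val_eqE /=; lia.
by apply: eq_bigl => v'; lia.
Qed.

(** In the triangle [a < t < b], weight entering through [(a, t)] leaves through [(t, b)], cutting
    the corner [t], or ends at [b], or leaves through [(a, b)], cutting the corner [a].
    [crossing_right] is the same for entry through [(t, b)]. *)
Lemma crossing_left s a t b : (a < t < b)%N -> (b < m)%N -> (forall p q, s p q = s q p) ->
  crossing s a t = \sum_(v < m | (a < v < t)%N) into s t b v + into s a t b +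
    \sum_(v < m | (a < v < t)%N) out s a b v.
Proof.
move=> atb bm sC; rewrite -!big_split /=; apply: eq_bigr => v _.
by rewrite (out_left _ _ atb bm) (sC b).
Qed.

Lemma crossing_right s a t b : (a < t < b)%N -> (b < m)%N -> (forall p q, s p q = s q p) ->
  crossing s t b = \sum_(v < m | (a < v < t)%N) into s t b v + into s t b a +
    \sum_(v < m | (t < v < b)%N) out s a b v.
Proof.
move=> atb bm sC; rewrite exchange_big -!big_split /=; apply: eq_bigr => v _.
rewrite (out_right _ _ atb bm) (sC a); congr (_ + _ + _).
by apply: eq_bigr => u _; apply: sC.
Qed.

Lemma intoP s a b v : into s a b v != 0 ->
  exists u, [/\ (u < m)%N, (a < u < b)%N & s v u != 0].
Proof. exact: (@sumr_ord_neq0 R m (fun u => a < u < b)%N). Qed.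

Lemma outP s a b v : out s a b v != 0 ->
  exists u, [/\ (u < m)%N, (u < a)%N || (b < u)%N & s v u != 0].
Proof. exact: (@sumr_ord_neq0 R m (fun u => (u < a) || (b < u))%N). Qed.

Lemma crossing_side s c : crossing s c c.+1 = 0.
Proof. by apply: big1 => u; lia. Qed.

Section Crossing.
Variables (s : nat -> nat -> R) (lam_s : lamination s).

Lemma into_ge0 c d v : 0 <= into s c d v.
Proof. by apply: sumr_ge0 => u _; apply: lam_ge0. Qed.

Lemma out_ge0 c d v : 0 <= out s c d v.
Proof. by apply: sumr_ge0 => u _; apply: lam_ge0. Qed.

Lemma crossing_ge0 c d : 0 <= crossing s c d.
Proof. by apply: sumr_ge0 => u _; apply: out_ge0. Qed.

Lemma lam_cross p q p' q' : (p < m)%N -> (q < m)%N -> (p' < m)%N -> (q' < m)%N ->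
  s p q != 0 -> s p' q' != 0 ->
  (p < p' < q)%N -> ((q' < p) || (q < q'))%N -> False.
Proof.
move=> pm qm p'm q'm spq sp'q' pp'q /orP[q'p|qq'].
  by apply: (@lam_noncross _ lam_s q' p p' q) => //; [lia|lia|rewrite lam_sym].
by apply: (@lam_noncross _ lam_s p p' q q') => //; lia.
Qed.

Lemma dcoord_noncross c d : (c < d < m)%N -> s c d = 0 \/ crossing s c d = 0.
Proof.
move=> cdm; have [|scd] := eqVneq (s c d) 0; [by left|right].
apply/eqP; apply: contraT.
move=> /(@sumr_ord_neq0 R m (fun v => c < v < d)%N (fun v => out s c d v)).
case=> v [vm cvd /outP[u [um ucd svu]]].
by case: (@lam_cross c d v u) => //; lia.
Qed.

(** One of the two terms of [dcoord] vanishes by [dcoord_noncross], so the crossing weight is its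
    positive part and, in [weightE], the weight of the chord its negative part. *)
Lemma crossingE c d : (c < d < m)%N -> crossing s c d = Num.max (dcoord s c d) 0.
Proof.
move=> cdm; have := lam_ge0 lam_s c d; have := crossing_ge0 c d; rewrite /dcoord.
by case: (dcoord_noncross cdm) => -> *; case: lerP; lra.
Qed.

Lemma weightE c d : (c < d < m)%N -> s c d = Num.max (- dcoord s c d) 0.
Proof.
move=> cdm; have := lam_ge0 lam_s c d; have := crossing_ge0 c d; rewrite /dcoord.
by case: (dcoord_noncross cdm) => -> *; case: lerP; lra.
Qed.

End Crossing.

(** * Chords meeting a triangle [a < t < b] *)

Section Triangle.
Variables (s : nat -> nat -> R) (a t b : nat).
Hypotheses (lam_s : lamination s) (atb : (a < t < b)%N) (bm : (b < m)%N).

Let sumP (Q : pred nat) (f : nat -> R) := @sumr_ord_neq0 R m Q f.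

(** A chord that ends at [b] and crosses the opposite side [(a, t)] would cross every chord that
    passes from [a] or [t] through its opposite side, and every chord that cuts the corner [b]. The
    next two lemmas give the remaining exclusions for [a] and [t]. *)
Lemma triangle_exclusive_b : into s a t b = 0 \/
  [/\ into s t b a = 0, out s a b t = 0 & \sum_(v < m | (t < v < b)%N) out s a b v = 0].
Proof.
have [|/intoP[v [vm avt sbv]]] := eqVneq (into s a t b) 0; [by left|right].
split; apply/eqP/contraT.
- by case/intoP=> u [um tub sau]; case: (@lam_cross s lam_s a u v b) => //; rewrite ?(lam_sym lam_s v); lia.
- by case/outP=> u [um uab stu]; case: (@lam_cross s lam_s v b t u) => //; rewrite ?(lam_sym lam_s v); lia.
- case/(sumP (Q := fun v => t < v < b)%N)=> u [um tub /outP[z [zm zab suz]]].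
  by case: (@lam_cross s lam_s v b u z) => //; rewrite ?(lam_sym lam_s v); lia.
Qed.

Lemma triangle_exclusive_a : into s t b a = 0 \/
  out s a b t = 0 /\ \sum_(v < m | (a < v < t)%N) out s a b v = 0.
Proof.
have [|/intoP[v [vm tvb sav]]] := eqVneq (into s t b a) 0; [by left|right].
split; apply/eqP/contraT.
- by case/outP=> u [um uab stu]; case: (@lam_cross s lam_s a v t u) => //; lia.
- case/(sumP (Q := fun v => a < v < t)%N)=> u [um aut /outP[z [zm zab suz]]].
  by case: (@lam_cross s lam_s a v u z) => //; lia.
Qed.

Lemma triangle_exclusive_t : out s a b t = 0 \/
  \sum_(v < m | (a < v < t)%N) into s t b v = 0.
Proof.
have [|/outP[z [zm zab stz]]] := eqVneq (out s a b t) 0; [by left|right].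
apply/eqP/contraT.
case/(sumP (Q := fun v => a < v < t)%N)=> u [um aut /intoP[v [vm tvb suv]]].
by case: (@lam_cross s lam_s u v t z) => //; lia.
Qed.

End Triangle.

(** The columns list, in cyclic order, where a chord from [v] through [(a, t)] can go: beyond
    [(t, b)], to [b], beyond [(a, b)]. In this order non-crossing means staircase. [right_matrix]
    does the same for chords through [(t, b)], starting beyond [(a, b)]. Rows of other vertices are
    [0], so that rows range over all [m] vertices. *)
Definition left_matrix s a t b v j : R :=
  if (a < v < t)%N then
    match j with 0 => into s t b v | 1 => s v b | _ => out s a b v end
  else 0.

Definition right_matrix s a t b u j : R :=
  if (t < u < b)%N then
    match j with 0 => out s a b u | 1 => s u a | _ => into s a t u end
  else 0.

Definition middle_matrix s a t b v u : R :=
  if (a < v < t)%N && (t < u < b)%N then s v u else 0.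

Section Matrices.
Variables (s : nat -> nat -> R) (a t b : nat).
Hypotheses (lam_s : lamination s) (atb : (a < t < b)%N) (bm : (b < m)%N).

Lemma left_matrix_ge0 v j : 0 <= left_matrix s a t b v j.
Proof.
rewrite /left_matrix; case: ifP => // _.
by case: j => [|[|j]]; [apply: into_ge0|apply: lam_ge0|apply: out_ge0].
Qed.

Lemma right_matrix_ge0 v j : 0 <= right_matrix s a t b v j.
Proof.
rewrite /right_matrix; case: ifP => // _.
by case: j => [|[|j]]; [apply: out_ge0|apply: lam_ge0|apply: into_ge0].
Qed.

Lemma middle_matrix_ge0 v j : 0 <= middle_matrix s a t b v j.
Proof. by rewrite /middle_matrix; case: ifP => // _; apply: lam_ge0. Qed.

Lemma left_matrix_neq0 v j : (j < 3)%N -> left_matrix s a t b v j != 0 ->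
  exists z, [/\ (z < m)%N, (a < v < t)%N, s v z != 0 &
    match j with 0 => (t < z < b)%N | 1 => z == b | _ => (z < a)%N || (b < z)%N end].
Proof.
rewrite /left_matrix; case: ifP => [avt|]; last by rewrite eqxx.
case: j => [|[|[|//]]] _.
- by case/intoP=> u [um tub su]; exists u.
- by move=> nz; exists b.
- by case/outP=> u [um tub su]; exists u.
Qed.

Lemma right_matrix_neq0 v j : (j < 3)%N -> right_matrix s a t b v j != 0 ->
  exists z, [/\ (z < m)%N, (t < v < b)%N, s v z != 0 &
    match j with 0 => (z < a)%N || (b < z)%N | 1 => z == a | _ => (a < z < t)%N end].
Proof.
rewrite /right_matrix; case: ifP => [avt|]; last by rewrite eqxx.
case: j => [|[|[|//]]] _.
- by case/outP=> u [um tub su]; exists u.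
- by move=> nz; exists a; split => //; lia.
- by case/intoP=> u [um tub su]; exists u.
Qed.

Lemma left_staircase : staircase m 3 (left_matrix s a t b).
Proof.
move=> v1 v2 j1 j2 v12 j12.
have [|/left_matrix_neq0 nz1] := eqVneq (left_matrix s a t b v1 j1) 0; [by left|right].
apply/eqP/contraT => /left_matrix_neq0.
move=> /(_ ltac:(lia))[z2 [z2m av2t s2 h2]].
have [z1 [z1m av1t s1 h1]] := nz1 ltac:(lia).
case: (@lam_cross s lam_s v1 z1 v2 z2) => //.
all: case: j1 h1 j12 {nz1} => [|[|j1]]; case: j2 h2 => [|[|j2]]; lia.
Qed.

Lemma right_staircase : staircase m 3 (right_matrix s a t b).
Proof.
move=> v1 v2 j1 j2 v12 j12.
have [|/right_matrix_neq0 nz1] := eqVneq (right_matrix s a t b v1 j1) 0; [by left|right].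
apply/eqP/contraT => /right_matrix_neq0.
move=> /(_ ltac:(lia))[z2 [z2m av2t s2 h2]].
have [z1 [z1m av1t s1 h1]] := nz1 ltac:(lia).
case: (@lam_cross s lam_s z2 v2 v1 z1); rewrite ?(lam_sym lam_s z2) //.
all: case: j1 h1 j12 {nz1} => [|[|j1]]; case: j2 h2 => [|[|j2]]; lia.
Qed.

Lemma middle_staircase : staircase m m (middle_matrix s a t b).
Proof.
move=> v1 v2 u1 u2 v12 u12; rewrite /middle_matrix.
case: ifP => [h1|_]; last by left.
case: ifP => [h2|_]; last by right.
have [|s1] := eqVneq (s v1 u1) 0; [by left|right].
apply/eqP/contraT => s2.
by case: (@lam_cross s lam_s v1 u1 v2 u2) => //; lia.
Qed.

Lemma left_matrix_row v :
  \sum_(j < 3) left_matrix s a t b v j = if (a < v < t)%N then out s a t v else 0.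
Proof.
rewrite !big_ord_recl big_ord0 addr0 /left_matrix /=; case: ifP => _.
  by rewrite (out_left _ _ atb bm) addrA.
by rewrite !addr0.
Qed.

Lemma right_matrix_row v :
  \sum_(j < 3) right_matrix s a t b v j = if (t < v < b)%N then out s t b v else 0.
Proof.
rewrite !big_ord_recl big_ord0 addr0 /right_matrix /=; case: ifP => _.
  by rewrite (out_right _ _ atb bm); ring.
by rewrite !addr0.
Qed.

Lemma left_matrix_col j : (j < 3)%N -> \sum_(v < m) left_matrix s a t b v j =
  match j with 0 => \sum_(v < m | (a < v < t)%N) into s t b v
  | 1 => into s a t b | _ => \sum_(v < m | (a < v < t)%N) out s a b v end.
Proof.
rewrite /left_matrix -big_mkcond; case: j => [|[|[|//]]] // _.
by apply: eq_bigr => v _; apply: lam_sym.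
Qed.

Lemma right_matrix_col j : (j < 3)%N -> \sum_(v < m) right_matrix s a t b v j =
  match j with 0 => \sum_(v < m | (t < v < b)%N) out s a b v
  | 1 => into s t b a | _ => \sum_(v < m | (a < v < t)%N) into s t b v end.
Proof.
rewrite /right_matrix -big_mkcond; case: j => [|[|[|//]]] // _.
  by apply: eq_bigr => v _; apply: lam_sym.
rewrite exchange_big; apply: eq_bigr => v _; apply: eq_bigr => u _; exact: lam_sym.
Qed.

Lemma middle_matrix_row v : \sum_(u < m) middle_matrix s a t b v u =
  if (a < v < t)%N then into s t b v else 0.
Proof.
rewrite /middle_matrix; case: ifP => _ /=; last by rewrite big1.
by rewrite -big_mkcond.
Qed.

Lemma middle_matrix_col u : \sum_(v < m) middle_matrix s a t b v u =
  if (t < u < b)%N then into s a t u else 0.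
Proof.
rewrite /middle_matrix; case: ifP => _; last by rewrite big1 // => v _; rewrite andbF.
under eq_bigr do rewrite andbT.
by rewrite -big_mkcond; apply: eq_bigr => v _; apply: lam_sym.
Qed.

End Matrices.

(** The three crossing sums fix the weight at each corner and at each vertex of the triangle. These
    are the column sums of the left and right matrices, whose row sums are given, so
    [staircase_unique] determines both matrices and then the middle one. *)
Lemma triangle_unique s s' a t b : lamination s -> lamination s' ->
  (a < t < b)%N -> (b < m)%N ->
  (forall v, (a < v < t)%N -> out s a t v = out s' a t v) ->
  (forall v, (t < v < b)%N -> out s t b v = out s' t b v) ->
  crossing s a b = crossing s' a b ->
  [/\ forall v, (a < v < b)%N -> out s a b v = out s' a b v,
      forall v u, (a < v < t)%N -> (t < u < b)%N -> s v u = s' v u,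
      forall v, (a < v < t)%N -> s v b = s' v b
    & forall u, (t < u < b)%N -> s a u = s' a u].
Proof.
move=> ls ls' atb bm out_at out_tb cr_ab.
have cr_at : crossing s a t = crossing s' a t by apply: eq_bigr => v /out_at.
have cr_tb : crossing s t b = crossing s' t b by apply: eq_bigr => v /out_tb.
have := cr_ab; rewrite /crossing !(sum_split _ atb bm) => cr_ab'.
have := cr_at; rewrite (crossing_left atb bm (lam_sym ls))
  (crossing_left atb bm (lam_sym ls')) => cr_at'.
have := cr_tb; rewrite (crossing_right atb bm (lam_sym ls))
  (crossing_right atb bm (lam_sym ls')) => cr_tb'.
have sum0 (P : pred nat) (f : nat -> R) :
    (forall v, 0 <= f v) -> 0 <= \sum_(v < m | P v) f v.
  by move=> f0; apply: sumr_ge0 => v _; apply: f0.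
have := triangle_exclusive_b ls atb bm; have := triangle_exclusive_b ls' atb bm.
have := triangle_exclusive_a ls atb bm; have := triangle_exclusive_a ls' atb bm.
have := triangle_exclusive_t ls atb bm; have := triangle_exclusive_t ls' atb bm.
have := into_ge0 ls a t b; have := into_ge0 ls' a t b.
have := into_ge0 ls t b a; have := into_ge0 ls' t b a.
have := out_ge0 ls a b t; have := out_ge0 ls' a b t.
have := sum0 (fun v => a < v < t)%N _ (into_ge0 ls t b).
have := sum0 (fun v => a < v < t)%N _ (into_ge0 ls' t b).
have := sum0 (fun v => a < v < t)%N _ (out_ge0 ls a b).
have := sum0 (fun v => a < v < t)%N _ (out_ge0 ls' a b).
have := sum0 (fun v => t < v < b)%N _ (out_ge0 ls a b).
have := sum0 (fun v => t < v < b)%N _ (out_ge0 ls' a b).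
have colsL j := @left_matrix_col s a t b ls j.
have colsL' j := @left_matrix_col s' a t b ls' j.
have colsR j := @right_matrix_col s a t b ls j.
have colsR' j := @right_matrix_col s' a t b ls' j.
move: cr_ab' cr_at' cr_tb' colsL colsL' colsR colsR'.
set A := \sum_(v < m | _) out s a b v; set A' := \sum_(v < m | _) out s' a b v.
set C := \sum_(v < m | _) out s a b v; set C' := \sum_(v < m | _) out s' a b v.
set B := \sum_(v < m | _) into s t b v; set B' := \sum_(v < m | _) into s' t b v.
set ea := into s t b a; set ea' := into s' t b a.
set eb := into s a t b; set eb' := into s' a t b.
set et := out s a b t; set et' := out s' a b t.
move=> e1 e2 e3 colsL colsL' colsR colsR' c0 c0' a0 a0' b0 b0'.
move=> et0 et0' ea0 ea0' eb0 eb0' xt' xt xa' xa xb' xb.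
have [[eA eB eC] [eea eeb eet]] :
    [/\ A = A', B = B' & C = C'] /\ [/\ ea = ea', eb = eb' & et = et'].
  clear colsL colsL' colsR colsR'; clearbody A A' B B' C C' ea ea' eb eb' et et'.
  clear -e1 e2 e3 c0 c0' a0 a0' b0 b0' et0 et0' ea0 ea0' eb0 eb0' xt' xt xa' xa xb' xb.
  (* The crossing sums determine [eb - (ea + et + C + C)], and one of [eb] and the bracket is [0] by
     the exclusions, so [eb] is the positive part of the difference. The same works for [ea] and
     [et]. *)
  have excess (x y x' y' : R) : 0 <= x -> 0 <= y -> 0 <= x' -> 0 <= y' ->
      x = 0 \/ y = 0 -> x' = 0 \/ y' = 0 -> x - y = x' - y' -> x = x'.
    by move=> ? ? ? ? [] ? [] ? ?; lra.
  have eeb : eb = eb'.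
    apply: (excess _ (ea + et + C + C) _ (ea' + et' + C' + C'));
      try by clear -c0 c0' ea0 ea0' eb0 eb0' et0 et0'; lra.
    - by case: xb => [|[]] *; [left|right; lra].
    - by case: xb' => [|[]] *; [left|right; lra].
    - by clear -e1 e2 e3; lra.
  have eea : ea = ea'.
    apply: (excess _ (eb + et + A + A) _ (eb' + et' + A' + A'));
      try by clear -a0 a0' ea0 ea0' eb0 eb0' et0 et0'; lra.
    - case: xa => [|[]] ? *; [by left|case: xb => [|[]] *; [right; lra|by left]].
    - case: xa' => [|[]] ? *; [by left|case: xb' => [|[]] *; [right; lra|by left]].
    - by clear -e1 e2 e3; lra.
  have eet : et = et'.
    apply: (excess _ (ea + eb + B + B) _ (ea' + eb' + B' + B'));
      try by clear -b0 b0' ea0 ea0' eb0 eb0' et0 et0'; lra.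
    - case: xt => ?; [by left|case: xa => [|[]] ? *; [|by left]].
      by case: xb => [|[]] *; [right; lra|by left].
    - case: xt' => ?; [by left|case: xa' => [|[]] ? *; [|by left]].
      by case: xb' => [|[]] *; [right; lra|by left].
    - by clear -e1 e2 e3; lra.
  by subst; clear -e1 e2 e3; do 2 split; lra.
have eqL v j : (v < m)%N -> (j < 3)%N -> left_matrix s a t b v j = left_matrix s' a t b v j.
  apply: (@staircase_unique R m 3) => //.
  - by move=> *; apply: left_matrix_ge0.
  - by move=> *; apply: left_matrix_ge0.
  - exact: left_staircase.
  - exact: left_staircase.
  - move=> i _; rewrite !left_matrix_row //.
    by case: ifP => // /out_at.
  - by move=> i i3; rewrite colsL // colsL' //; case: i i3 => [|[|[|]]].
have eqR v j : (v < m)%N -> (j < 3)%N -> right_matrix s a t b v j = right_matrix s' a t b v j.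
  apply: (@staircase_unique R m 3) => //.
  - by move=> *; apply: right_matrix_ge0.
  - by move=> *; apply: right_matrix_ge0.
  - exact: right_staircase.
  - exact: right_staircase.
  - move=> i _; rewrite !right_matrix_row //.
    by case: ifP => // /out_tb.
  - by move=> i i3; rewrite colsR // colsR' //; case: i i3 => [|[|[|]]].
(* Column [0] of the left matrix and column [2] of the right one are the row and column sums of the
   matrix of chords that cut the corner [t]. *)
have eqM v u : (v < m)%N -> (u < m)%N -> middle_matrix s a t b v u = middle_matrix s' a t b v u.
  apply: (@staircase_unique R m m) => //.
  - by move=> *; apply: middle_matrix_ge0.
  - by move=> *; apply: middle_matrix_ge0.
  - exact: middle_staircase.
  - exact: middle_staircase.
  - move=> i im; rewrite !middle_matrix_row.
    by have := eqL i 0 im isT; rewrite /left_matrix; case: ifP.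
  - move=> i im; rewrite !middle_matrix_col //.
    by have := eqR i 2 im isT; rewrite /right_matrix; case: ifP.
clear -ls ls' atb bm eqL eqR eqM eet.
split.
- move=> v avb; have [vt|tv|->] := ltngtP v t; last exact: eet.
    have avt : (a < v < t)%N by rewrite vt andbT; case/andP: avb.
    by have := eqL v 2 ltac:(lia) isT; rewrite /left_matrix avt.
  have tvb : (t < v < b)%N by rewrite tv; case/andP: avb.
  by have := eqR v 0 ltac:(lia) isT; rewrite /right_matrix tvb.
- move=> v u avt tub; have := eqM v u ltac:(lia) ltac:(lia).
  by rewrite /middle_matrix avt tub.
- move=> v avt; have := eqL v 1 ltac:(lia) isT.
  by rewrite /left_matrix avt.
- move=> u tub; have := eqR u 1 ltac:(lia) isT.
  by rewrite /right_matrix tub (lam_sym ls) (lam_sym ls').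
Qed.

End Lamination.

(** * Recursion along a dissection *)

Ltac nat_lia := intros; lazymatch goal with R : realFieldType |- _ =>
  repeat match goal with H : context [R] |- _ => clear H end end; lia.

(** The edges of a triangulation, sides included, as a binary tree: below an edge that is not a side
    hang the two shorter sides of the triangle under it. *)
Record dissection m (E : nat -> nat -> Prop) : Prop := Dissection {
  dis_lt : forall p q, E p q -> (p < q < m)%N;
  dis_noncross : forall p p' q q', (p < p' < q)%N -> (q < q')%N ->
    E p q -> E p' q' -> False;
  dis_third : forall p q, E p q -> (p.+1 < q)%N ->
    exists t, [/\ (p < t < q)%N, E p t & E t q] }.

Section Dissection.
Variables (R : realFieldType).
Implicit Types (s : nat -> nat -> R) (E : nat -> nat -> Prop).

(** Induction on [b - a]. The weights leaving through [(a, b)] belong to the claim because, for the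
    two shorter sides, they are the input of [triangle_unique]; the total crossing [(a, b)] is the
    positive part of its coordinate. *)
Lemma dissection_unique m E s s' a b : dissection m E ->
  lamination m s -> lamination m s' ->
  (forall p q, E p q -> dcoord m s p q = dcoord m s' p q) -> E a b ->
  (forall v, (a < v < b)%N -> out m s a b v = out m s' a b v) /\
  (forall p q, (a <= p < q)%N -> (q <= b)%N -> s p q = s' p q).
Proof.
move=> dE ls ls' eqc; have [k] := ubnP (b - a); elim: k a b => [//|k IHk] a b.
rewrite ltnS => bak Eab; have abm := dis_lt dE Eab.
have [b1|b1] : b = a.+1 \/ (a.+1 < b)%N by lia.
  split=> [v|p q]; first by lia.
  move=> apq qb; have [-> ->] : p = a /\ q = a.+1 by lia.
  by rewrite (lam_side ls) (lam_side ls').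
have [t [atb Eat Etb]] := dis_third dE Eab b1.
have [out_at s_at] := IHk a t ltac:(lia) Eat.
have [out_tb s_tb] := IHk t b ltac:(lia) Etb.
have bm : (b < m)%N by lia.
have cr_ab : crossing m s a b = crossing m s' a b.
  by rewrite (crossingE ls) // (crossingE ls') // eqc.
have [out_ab s_mid s_b s_a] := triangle_unique ls ls' atb bm out_at out_tb cr_ab.
split => // p q apq qb.
case: (leqP q t) => [qt|tq]; first exact: s_at.
case: (leqP t p) => [tp|pt]; first by apply: s_tb => //; lia.
have [pa|ap] : p = a \/ (a < p)%N by lia.
  have [qb'|qb'] : q = b \/ (q < b)%N by lia.
    by rewrite pa qb' (weightE ls) // (weightE ls') // eqc.
  by rewrite pa; apply: s_a; lia.
have [qb'|qb'] : q = b \/ (q < b)%N by lia.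
  by rewrite qb'; apply: s_b; lia.
by apply: s_mid; lia.
Qed.

(* [A], [B], [C] cut the corners [a], [t], [b] of a triangle whose sides [(a, t)],
   [(t, b)], [(a, b)] are crossed with weights [p], [q], [w]; [ea], [et], [eb] end
   at these vertices. *)
Lemma triangle_masses (p q w : R) : 0 <= p -> 0 <= q -> 0 <= w ->
  exists A B C ea eb et : R,
  [/\ [/\ 0 <= A, 0 <= B & 0 <= C], [/\ 0 <= ea, 0 <= eb & 0 <= et],
      [/\ p = B + eb + A, q = B + ea + C & w = A + et + C],
      [/\ eb = 0 \/ ea = 0, eb = 0 \/ et = 0 & ea = 0 \/ et = 0]
    & [/\ eb = 0 \/ C = 0, ea = 0 \/ A = 0 & et = 0 \/ B = 0]].
Proof.
move=> p0 q0 w0.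
(* If one side is crossed by more than the other two together, the excess ends at the opposite
   vertex. Otherwise the triangle inequalities hold and all weight cuts corners. *)
case: (lerP p (q + w)) => hp; last first.
  exists w, q, 0, 0, (p - q - w), 0.
  by split; split; try (by left); try (by right); lra.
case: (lerP q (p + w)) => hq; last first.
  exists 0, p, w, (q - p - w), 0, 0.
  by split; split; try (by left); try (by right); lra.
case: (lerP w (p + q)) => hw; last first.
  exists p, 0, q, 0, 0, (w - p - q).
  by split; split; try (by left); try (by right); lra.
exists ((p + w - q) / 2), ((p + q - w) / 2), ((q + w - p) / 2), 0, 0, 0.
by split; split; try (by left); try (by right); lra.
Qed.

(** * Gluing two laminations along a triangle *)

Section Glue.
Variable M : nat.
Local Notation m := M.+1.

(* Weight on [v M] with [a < v < b] stands for weight that ends at [v] and leaves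
   the interval [a, b] through the edge [(a, b)]; its other end is not yet known. *)
Definition supported a b s := forall p q, (p < q)%N -> s p q != 0 ->
  (a <= p)%N /\ ((q <= b)%N \/ q = M /\ (a < p < b)%N).

Lemma out_top s a b v : lamination m s -> supported a b s -> (b < M)%N ->
  (a < v < b)%N -> out m s a b v = s v M.
Proof.
move=> ls sup bM avb; rewrite /out (bigD1 (Ordinal (ltnSn M))) /=; last by lia.
rewrite big1 ?addr0 // => u /andP[uab uM].
have {}uM : (u : nat) <> M by move=> e; case/eqP: uM; apply: val_inj.
apply/eqP/contraT => su; case/orP: uab => h.
  by have := sup u v; rewrite (lam_sym ls) => /(_ _ su); lia.
by have := sup v u ltac:(lia) su; lia.
Qed.

(** An edge inside [[a, b]] sees a chord that leaves through [(a, b)] only by its end inside. So the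
    other ends may be rerouted as long as each [v] keeps its total. *)
Lemma coord_local s s' a b p q : (forall v u, s v u = s u v) -> (forall v u, s' v u = s' u v) ->
  (forall v u, (a <= v < u)%N -> (u <= b)%N -> s v u = s' v u) ->
  (forall v, (a < v < b)%N -> out m s a b v = out m s' a b v) ->
  (a <= p < q)%N -> (q <= b)%N -> dcoord m s p q = dcoord m s' p q.
Proof.
move=> sC s'C eqs eqo apq qb; rewrite /dcoord eqs //; congr (_ - _).
apply: eq_bigr => v pvq; rewrite /out.
rewrite (bigID (fun u : 'I_m => (u < a) || (b < u))%N)
  [RHS](bigID (fun u : 'I_m => (u < a) || (b < u))%N) /=.
congr (_ + _).
  pose P (u : 'I_m) := (u < a)%N || (b < u)%N.
  rewrite (eq_bigl P) => [|u]; last by rewrite /P; lia.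
  rewrite [RHS](eq_bigl P) => [|u]; last by rewrite /P; lia.
  by apply: eqo; lia.
apply: eq_bigr => u hu; have [vu|uv] : (v < u)%N \/ (u < v)%N by lia.
  by apply: eqs; lia.
by rewrite sC s'C; apply: eqs; lia.
Qed.

Lemma psum_eq0 k (f : nat -> R) i : (forall i, 0 <= f i) -> \sum_(i < k) f i = 0 ->
  (i < k)%N -> f i = 0.
Proof.
move=> f0 /eqP; rewrite psumr_eq0 // => /allP z ik.
by apply/eqP/(z (Ordinal ik)); rewrite mem_index_enum.
Qed.

(** The weight pending at [M] in [s1] and [s2] enters the triangle through [(a, t)] and [(t, b)]. It
    is routed as [triangle_masses] prescribes, and what leaves through [(a, b)] is parked at [M]
    again. *)
Lemma glue a t b (x : R) s1 s2 : (a < t < b)%N -> (b < M)%N ->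
  lamination m s1 -> supported a t s1 -> lamination m s2 -> supported t b s2 ->
  exists s, [/\ lamination m s, supported a b s, dcoord m s a b = x,
    forall p q, (a <= p < q)%N -> (q <= t)%N -> dcoord m s p q = dcoord m s1 p q
  & forall p q, (t <= p < q)%N -> (q <= b)%N -> dcoord m s p q = dcoord m s2 p q].
Proof.
move=> atb bM ls1 sup1 ls2 sup2.
pose r1 v := if (a < v < t)%N then s1 v M else 0.
pose r2 u := if (t < u < b)%N then s2 u M else 0.
have r1_ge0 v : 0 <= r1 v by rewrite /r1; case: ifP => // _; apply: lam_ge0 ls1 _ _.
have r2_ge0 v : 0 <= r2 v by rewrite /r2; case: ifP => // _; apply: lam_ge0 ls2 _ _.
(* The positive part of [x] is to cross [(a, b)], the negative part is put on the chord [(a, b)]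
   itself. *)
pose w := Num.max x 0; pose sab := Num.max (- x) 0.
have w0 : 0 <= w by rewrite le_max lexx orbT.
have sab0 : 0 <= sab by rewrite le_max lexx orbT.
have wsab : w - sab = x by rewrite /w /sab; case: (lerP x 0) => ?; case: (lerP (- x) 0) => ?; lra.
have wsab0 : sab = 0 \/ w = 0.
  by rewrite /w /sab; case: (lerP x 0) => ?; [by right|left]; case: (lerP (- x) 0) => ?; lra.
have P0 : 0 <= \sum_(v < m) r1 v by apply: sumr_ge0.
have Q0 : 0 <= \sum_(v < m) r2 v by apply: sumr_ge0.
have [A [B [C [ea [eb [et [[A0 B0 C0] [ea0 eb0 et0] [eP eQ eW] [xba xbt xat] [xbC xaA xtB]]]]]]]] :=
  triangle_masses P0 Q0 w0.
(* The columns are ordered as in [left_matrix]: corner [t], end at [b], corner [a]. Those of [Q]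
   follow [right_matrix]: corner [b], end at [a], corner [t]. *)
have [|||L [L0 stL rowL colL]] := @staircase_exists R m 3 r1
    (fun j => match j with 0 => B | 1 => eb | _ => A end)%N.
- by [].
- by case=> [|[|j]].
- by rewrite eP !big_ord_recl big_ord0 /=; ring.
have [|||Q [QQ0 stQ rowQ colQ]] := @staircase_exists R m 3 r2
    (fun j => match j with 0 => C | 1 => ea | _ => B end)%N.
- by [].
- by case=> [|[|j]].
- by rewrite eQ !big_ord_recl big_ord0 /=; ring.
(* [K] matches the two halves of the chords that cut the corner [t]; both halves have total weight
   [B]. *)
have [|||K [K0 stK rowK colK]] := @staircase_exists R m m (fun v => L v 0%N) (fun u => Q u 2%N).
- by move=> v vm; apply: L0.
- by move=> v vm; apply: QQ0.
- by rewrite (colL 0%N) // (colQ 2%N).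
have row0 k l (N : nat -> nat -> R) i j : (forall i j, (i < k)%N -> (j < l)%N -> 0 <= N i j) ->
    \sum_(j < l) N i j = 0 -> (i < k)%N -> (j < l)%N -> N i j = 0.
  move=> N0 /eqP + ik jl; rewrite psumr_eq0 => [/allP z|j' _]; last by apply: N0.
  by apply/eqP/(z (Ordinal jl)); rewrite mem_index_enum.
have col0 k l (N : nat -> nat -> R) i j : (forall i j, (i < k)%N -> (j < l)%N -> 0 <= N i j) ->
    \sum_(i < k) N i j = 0 -> (i < k)%N -> (j < l)%N -> N i j = 0.
  move=> N0 z ik jl; apply: (row0 l k (fun j i => N i j)) => // j' i' *; exact: N0.
have Lout v j : (v < m)%N -> (j < 3)%N -> L v j != 0 -> (a < v < t)%N /\ s1 v M != 0.
  move=> vm j3 nz; have rv : r1 v != 0.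
    by apply: contra_neq nz => z; apply: (row0 m 3%N) => //; rewrite rowL.
  by move: rv; rewrite /r1; case: ifP => //; rewrite eqxx.
have Qout v j : (v < m)%N -> (j < 3)%N -> Q v j != 0 -> (t < v < b)%N /\ s2 v M != 0.
  move=> vm j3 nz; have rv : r2 v != 0.
    by apply: contra_neq nz => z; apply: (row0 m 3%N) => //; rewrite rowQ.
  by move: rv; rewrite /r2; case: ifP => //; rewrite eqxx.
have KL v u : (v < m)%N -> (u < m)%N -> K v u != 0 -> L v 0%N != 0.
  by move=> vm um; apply: contra_neq => z; apply: (row0 m m) => //; rewrite rowK.
have KQ v u : (v < m)%N -> (u < m)%N -> K v u != 0 -> Q u 2%N != 0.
  by move=> vm um; apply: contra_neq => z; apply: (col0 m m) => //; rewrite colK.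
have LB v : (v < m)%N -> L v 0%N != 0 -> B != 0.
  by move=> vm; apply: contra_neq => z; apply: (col0 m 3%N) => //; rewrite colL.
have Leb v : (v < m)%N -> L v 1%N != 0 -> eb != 0.
  by move=> vm; apply: contra_neq => z; apply: (col0 m 3%N) => //; rewrite colL.
have LA v : (v < m)%N -> L v 2%N != 0 -> A != 0.
  by move=> vm; apply: contra_neq => z; apply: (col0 m 3%N) => //; rewrite colL.
have QC v : (v < m)%N -> Q v 0%N != 0 -> C != 0.
  by move=> vm; apply: contra_neq => z; apply: (col0 m 3%N) => //; rewrite colQ.
have Qea v : (v < m)%N -> Q v 1%N != 0 -> ea != 0.
  by move=> vm; apply: contra_neq => z; apply: (col0 m 3%N) => //; rewrite colQ.
(* Chords on one side of [t] keep their old weights, chords passing [t] inside [[a, b]] are read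
   from [Q], [K], [L] and [sab], and the chords to [M] carry the weight that leaves through
   [(a, b)]. *)
pose g p q := if (q <= t)%N then s1 p q
  else if (t <= p)%N && (q <= b)%N then s2 p q
  else if (p == a) && (q == b) then sab
  else if (p == a) && (t < q < b)%N then Q q 1%N
  else if (a < p < t)%N && (t < q < b)%N then K p q
  else if (a < p < t)%N && (q == b) then L p 1%N
  else if (a < p < t)%N && (q == M) then L p 2%N
  else if (p == t) && (q == M) then et
  else if (t < p < b)%N && (q == M) then Q p 0%N else 0.
pose s p q := if (p < q < m)%N then g p q else if (q < p < m)%N then g q p else 0.
have sE p q : (p < q < m)%N -> s p q = g p q by move=> pq; rewrite /s pq.
have gP p q : (p < q < m)%N -> g p q != 0 ->
  [\/ [/\ (a <= p)%N, (q <= t)%N & s1 p q != 0] \/ [/\ (t <= p)%N, (q <= b)%N & s2 p q != 0]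
    \/ [/\ p = a, q = b & sab != 0],
    [/\ p = a, (t < q < b)%N & Q q 1%N != 0] \/ [/\ (a < p < t)%N, (t < q < b)%N & K p q != 0],
    [/\ (a < p < t)%N, q = b & L p 1%N != 0] \/ [/\ (a < p < t)%N, q = M & L p 2%N != 0]
  | [/\ p = t, q = M & et != 0] \/ [/\ (t < p < b)%N, q = M & Q p 0%N != 0]].
  move=> /andP[pq _]; rewrite /g; case: ifP => [qt nz|_].
    by constructor 1; left; split => //; case: (sup1 p q pq nz).
  case: ifP => [/andP[tp qb] nz|_]; first by constructor 1; right; left.
  case: ifP => [/andP[/eqP pa /eqP qb] nz|_]; first by constructor 1; right; right.
  case: ifP => [/andP[/eqP pa qb] nz|_]; first by constructor 2; left.
  case: ifP => [/andP[pa qb] nz|_]; first by constructor 2; right.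
  case: ifP => [/andP[pa /eqP qb] nz|_]; first by constructor 3; left.
  case: ifP => [/andP[pa /eqP qb] nz|_]; first by constructor 3; right.
  case: ifP => [/andP[/eqP pa /eqP qb] nz|_]; first by constructor 4; left.
  case: ifP => [/andP[pa /eqP qb] nz|_]; first by constructor 4; right.
  by rewrite eqxx.
have gK v u : (a < v < t)%N -> (t < u < b)%N -> g v u = K v u.
  by move=> h1 h2; rewrite /g; do ![case: ifP; try nat_lia].
have gb v : (a < v < t)%N -> g v b = L v 1%N.
  by move=> h1; rewrite /g; do ![case: ifP; try nat_lia].
have gLM v : (a < v < t)%N -> g v M = L v 2%N.
  by move=> h1; rewrite /g; do ![case: ifP; try nat_lia].
have ga u : (t < u < b)%N -> g a u = Q u 1%N.
  by move=> h1; rewrite /g; do ![case: ifP; try nat_lia].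
have gQM u : (t < u < b)%N -> g u M = Q u 0%N.
  by move=> h1; rewrite /g; do ![case: ifP; try nat_lia].
have gtM : g t M = et.
  by rewrite /g; do ![case: ifP; try nat_lia].
have gab : g a b = sab.
  by rewrite /g; do ![case: ifP; try nat_lia].
have ls : lamination m s.
  split.
  - by move=> p q; rewrite /s; case: ltngtP => // ->.
  - have g0 p q : (p < q < m)%N -> 0 <= g p q.
      move=> pqm; rewrite /g.
      case: ifP => _; first exact: lam_ge0 ls1 _ _.
      case: ifP => _; first exact: lam_ge0 ls2 _ _.
      case: ifP => _ //; case: ifP => _; first by apply: QQ0 => //; nat_lia.
      case: ifP => _; first by apply: K0; nat_lia.
      case: ifP => _; first by apply: L0 => //; nat_lia.
      case: ifP => _; first by apply: L0 => //; nat_lia.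
      case: ifP => _ //; case: ifP => _ //; by apply: QQ0 => //; nat_lia.
    by move=> p q; rewrite /s; case: ifP => [/g0 //|_]; case: ifP => [/g0 //|_].
  - move=> p; rewrite /s; case: ifP => [pm|_]; last by case: ifP => //; nat_lia.
    apply/eqP/contraT => nz; case: (gP p p.+1 pm nz) => [[|[]]|[|]|[|]|[|]] [h1 h2 h3]; try nat_lia.
      by rewrite (lam_side ls1) eqxx in h3.
    by rewrite (lam_side ls2) eqxx in h3.
  - move=> p p' q q' pp'q qq'm; rewrite !sE; [|nat_lia|nat_lia].
    move=> /(gP p q ltac:(nat_lia)) nz /(gP p' q' ltac:(nat_lia)) nz'.
    have nL j1 j2 v v' : (a < v < t)%N -> (v < v')%N -> (v' < t)%N -> L v j1 != 0 -> L v' j2 != 0 ->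
        (j1 < j2 < 3)%N -> False.
      move=> h0 h1 h2 n1 n2 h3; case: (stL v v' j1 j2 _ h3) => [|z|z]; first by nat_lia.
        by rewrite z eqxx in n1.
      by rewrite z eqxx in n2.
    have nQ j1 j2 v v' : (t < v < b)%N -> (v < v')%N -> (v' < b)%N -> Q v j1 != 0 -> Q v' j2 != 0 ->
        (j1 < j2 < 3)%N -> False.
      move=> h0 h1 h2 n1 n2 h3; case: (stQ v v' j1 j2 _ h3) => [|z|z]; first by nat_lia.
        by rewrite z eqxx in n1.
      by rewrite z eqxx in n2.
    have nK v u v' u' : K v u != 0 -> K v' u' != 0 -> (v < v' < m)%N -> (u < u' < m)%N -> False.
      move=> n1 n2 h1 h2; case: (stK v v' u u' h1 h2) => z.
        by rewrite z eqxx in n1.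
      by rewrite z eqxx in n2.
    have excl (y z : R) : y = 0 \/ z = 0 -> y != 0 -> z != 0 -> False.
      by case=> ->; rewrite eqxx.
    (* Weight on the chord [(a, b)] means [w = 0], so nothing leaves through it. *)
    have sw : sab != 0 -> [/\ A = 0, et = 0 & C = 0].
      case: wsab0 => [-> /[!eqxx]//|w00 _]; clear -w00 eW A0 et0 C0; split; lra.
    case: nz => [[[h1 h2 h3]|[[h1 h2 h3]|[h1 h2 h3]]]|[[h1 h2 h3]|[h1 h2 h3]]
      |[[h1 h2 h3]|[h1 h2 h3]]|[[h1 h2 h3]|[h1 h2 h3]]];
    case: nz' => [[[i1 i2 i3]|[[i1 i2 i3]|[i1 i2 i3]]]|[[i1 i2 i3]|[i1 i2 i3]]
      |[[i1 i2 i3]|[i1 i2 i3]]|[[i1 i2 i3]|[i1 i2 i3]]];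
    try by exfalso; nat_lia.

    (* The pairs left are excluded by the old laminations, where rerouted weight still goes to [M],
       by the staircase property of [L], [Q] and [K], or by the exclusions between the masses. *)
    + by apply: (lam_noncross ls1 pp'q qq'm).
    + by apply: (lam_noncross ls1 pp'q _ h3 (Lout p' 0%N _ isT (KL p' q' _ _ i3)).2); nat_lia.
    + by apply: (lam_noncross ls1 pp'q _ h3 (Lout p' 1%N _ isT i3).2); nat_lia.
    + by apply: (lam_noncross ls1 pp'q _ h3 (Lout p' 2%N _ isT i3).2); nat_lia.
    + by apply: (lam_noncross ls2 pp'q qq'm).
    + by apply: (lam_noncross ls2 pp'q _ h3 (Qout p' 0%N _ isT i3).2); nat_lia.
    + by have [z _ _] := sw h3; have := LA p' ltac:(nat_lia) i3; rewrite z eqxx.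
    + by have [_ z _] := sw h3; move: i3; rewrite z eqxx.
    + by have [_ _ z] := sw h3; have := QC p' ltac:(nat_lia) i3; rewrite z eqxx.
    + by apply: (@lam_noncross _ _ _ ls2 p' q q' M _ _ i3 (Qout q 1%N _ isT h3).2); nat_lia.
    + by apply: (nQ 1%N 2%N q q' _ _ _ h3 (KQ p' q' _ _ i3)); nat_lia.
    + by apply: excl xba (Leb p' _ i3) (Qea q _ h3); nat_lia.
    + by apply: excl xaA (Qea q _ h3) (LA p' _ i3); nat_lia.
    + by apply: excl xat (Qea q _ h3) i3; nat_lia.
    + by apply: (nQ 0%N 1%N p' q _ _ _ i3 h3); nat_lia.
    + by apply: (@lam_noncross _ _ _ ls2 p' q q' M _ _ i3 (Qout q 2%N _ isT (KQ p q _ _ h3)).2); nat_lia.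
    + by apply: (nK p q p' q' h3 i3); nat_lia.
    + by apply: (nL 0%N 1%N p p' _ _ _ (KL p q _ _ h3) i3); nat_lia.
    + by apply: (nL 0%N 2%N p p' _ _ _ (KL p q _ _ h3) i3); nat_lia.
    + by apply: excl xtB i3 (LB p _ (KL p q _ _ h3)); nat_lia.
    + by apply: (nQ 0%N 2%N p' q _ _ _ i3 (KQ p q _ _ h3)); nat_lia.
    + by apply: (nL 1%N 2%N p p' _ _ _ h3 i3); nat_lia.
    + by apply: excl xbt (Leb p _ h3) i3; nat_lia.
    + by apply: excl xbC (Leb p _ h3) (QC p' _ i3); nat_lia.
have supp : supported a b s.
  move=> p q pq; rewrite /s; case: ifP => [pqm|_]; last first.
    by case: ifP => [|_]; [nat_lia|rewrite eqxx].
  by move=> /(gP p q pqm) [[|[]]|[|]|[|]|[|]] [h1 h2 h3]; try nat_lia.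
have bm : (b < m)%N by exact: ltnW.
(* The row sums of [L] and [Q] say that each vertex still sends the same weight through [(a, t)] or
   [(t, b)], as [coord_local] requires. *)
have out_at v : (a < v < t)%N -> out m s a t v = out m s1 a t v.
  move=> avt; rewrite (out_top ls1 sup1) //; last by nat_lia.
  rewrite (out_left s v atb bm) (out_top ls supp) //; last by nat_lia.
  have -> : into m s t b v = L v 0%N.
    rewrite -(rowK v) ?/into; last by nat_lia.
    rewrite big_mkcond; apply: eq_bigr => u _; case: ifP => tub.
      by rewrite sE ?gK //; nat_lia.
    apply/esym/eqP/contraT => /KQ => /(_ ltac:(nat_lia) (ltn_ord u))/Qout.
    by case/(_ (ltn_ord u) isT); rewrite tub.
  rewrite !sE ?gb ?gLM //; try nat_lia.
  have := rowL v ltac:(nat_lia).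
  by rewrite !big_ord_recl big_ord0 addr0 addrA /r1 avt.
have out_tb u : (t < u < b)%N -> out m s t b u = out m s2 t b u.
  move=> tub; rewrite (out_top ls2 sup2) //.
  rewrite (out_right s u atb bm) (out_top ls supp) //; last by nat_lia.
  have -> : into m s a t u = Q u 2%N.
    rewrite -(colK u) ?/into; last by nat_lia.
    rewrite big_mkcond; apply: eq_bigr => v _; case: ifP => avt.
      by rewrite (lam_sym ls) sE ?gK //; nat_lia.
    apply/esym/eqP/contraT => /KL => /(_ (ltn_ord v) ltac:(nat_lia))/Lout.
    by case/(_ (ltn_ord v) isT); rewrite avt.
  rewrite (lam_sym ls u a) !sE ?ga ?gQM //; try nat_lia.
  have := rowQ u ltac:(nat_lia).
  rewrite !big_ord_recl big_ord0 /r2 tub => <- /=; ring.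
exists s; split => //.
- rewrite /dcoord sE ?gab /crossing; last by nat_lia.
  rewrite (sum_split _ atb bm) (out_top ls supp) // sE ?gtM; last by nat_lia.
  have -> : \sum_(v < m | (a < v < t)%N) out m s a b v = A.
    rewrite -(colL 2%N) // big_mkcond; apply: eq_bigr => v _; case: ifP => avt.
      by rewrite (out_top ls supp) ?sE ?gLM //; nat_lia.
    apply/esym/eqP/contraT => /Lout.
    by case/(_ (ltn_ord v) isT); rewrite avt.
  have -> : \sum_(v < m | (t < v < b)%N) out m s a b v = C.
    rewrite -(colQ 0%N) // big_mkcond; apply: eq_bigr => v _; case: ifP => tvb.
      by rewrite (out_top ls supp) ?sE ?gQM //; nat_lia.
    apply/esym/eqP/contraT => /Qout.
    by case/(_ (ltn_ord v) isT); rewrite tvb.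
  by rewrite -eW.
- move=> p q apq qt; apply: (coord_local (lam_sym ls) (lam_sym ls1) _ out_at) => // v u avu ut.
  by rewrite sE /g ?ut //; nat_lia.
- move=> p q apq qt; apply: (coord_local (lam_sym ls) (lam_sym ls2) _ out_tb) => // v u avu ut.
  rewrite sE /g; last by nat_lia.
  by do ![case: ifP; try nat_lia].
Qed.

(** The recursion starts from the zero lamination at a side and applies [glue] at each triangle. The
    dissected polygon has the vertices below [M]; [M] itself is the extra vertex that holds pending
    weight. *)
Lemma dissection_exist E (x : nat -> nat -> R) a b : dissection M E ->
  (forall p, x p p.+1 = 0) -> E a b ->
  exists s, [/\ lamination m s, supported a b s &
    forall p q, E p q -> (a <= p)%N -> (q <= b)%N -> dcoord m s p q = x p q].
Proof.
move=> dE x0; have [k] := ubnP (b - a); elim: k a b => [//|k IHk] a b.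
rewrite ltnS => bak Eab; have abm := dis_lt dE Eab.
have [b1|b1] : b = a.+1 \/ (a.+1 < b)%N by lia.
  exists (fun _ _ => 0); split.
  - by split => // p p' q q' _ _; rewrite eqxx.
  - by move=> p q _; rewrite eqxx.
  - move=> p q Epq ap qb; have pq := dis_lt dE Epq.
    have [-> ->] : p = a /\ q = a.+1 by lia.
    by rewrite /dcoord crossing_side subr0 x0.
have [t [atb Eat Etb]] := dis_third dE Eab b1.
have [s1 [ls1 sup1 co1]] := IHk a t ltac:(lia) Eat.
have [s2 [ls2 sup2 co2]] := IHk t b ltac:(lia) Etb.
have bM : (b < M)%N by lia.
have [s [ls sup co_ab co_at co_tb]] := glue (x a b) atb bM ls1 sup1 ls2 sup2.
exists s; split => // p q Epq ap qb; have pq := dis_lt dE Epq.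
case: (leqP q t) => qt; first by rewrite co_at ?co1 //; lia.
case: (leqP t p) => tp; first by rewrite co_tb ?co2 //; lia.
(* An edge passing [t] other than [(a, b)] would cross [(a, t)] or [(t, b)]. *)
have pa : p = a.
  have [//|ap'] : p = a \/ (a < p)%N by lia.
  by case: (@dis_noncross _ _ dE a p t q) => //; lia.
have qb' : q = b.
  have [//|ap'] : q = b \/ (q < b)%N by lia.
  by case: (@dis_noncross _ _ dE p t q b) => //; lia.
by rewrite pa qb'.
Qed.


End Glue.
End Dissection.

(** * Diagonals *)

Section Diagonals.
Variable n : nat.
Local Notation D := (polygon_diagonal n.+3).
Implicit Types (d e : D) (T S : {set D}).

Lemma is_diagonalE (d : 'I_n.+3 * 'I_n.+3) :
  is_diagonal d = (d.1.+1 < d.2)%N && ~~ ((d.1 == 0 :> nat) && (d.2 == n.+2 :> nat)).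
Proof.
case: d => [[i im] [j jm]]; rewrite /is_diagonal -!val_eqE /=.
have [i2|i2] : i = n.+2 \/ (i < n.+2)%N by lia.
  by rewrite i2; lia.
rewrite (modn_small (_ : i.+1 < n.+3)%N) //.
have [->|j2] : j = n.+2 \/ (j < n.+2)%N by lia.
  by rewrite modnn; lia.
rewrite (modn_small (_ : j.+1 < n.+3)%N) //.
by lia.
Qed.

Definition dsrc d : nat := (val d).1.
Definition dtgt d : nat := (val d).2.

Lemma diagP d : [/\ (dsrc d).+1 < dtgt d, dtgt d < n.+3 & dsrc d = 0 -> dtgt d < n.+2]%N.
Proof.
have := valP d; rewrite is_diagonalE => /andP[h1 h2].
by split=> //; move: h2; have := ltn_ord (val d).2; rewrite /dsrc /dtgt; lia.
Qed.

Lemma diag_inj d e : dsrc d = dsrc e -> dtgt d = dtgt e -> d = e.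
Proof.
rewrite /dsrc /dtgt => h1 h2; apply: val_inj.
by case: (val d) (val e) h1 h2 => [d1 d2] [e1 e2] /= /val_inj -> /val_inj ->.
Qed.

Lemma diag_exists p q : (p.+1 < q < n.+3)%N -> (p = 0 -> q < n.+2)%N ->
  exists d, dsrc d = p /\ dtgt d = q.
Proof.
move=> pq p0; have pm : (p < n.+3)%N by lia.
have qm : (q < n.+3)%N by lia.
have h : is_diagonal (Ordinal pm, Ordinal qm) by rewrite is_diagonalE /=; lia.
by exists (Sub _ h : D); rewrite /dsrc /dtgt /=.
Qed.

(** The combinatorial counterpart of [cross] for distinct diagonals; unlike [cross], it fails when
    [d = e]. *)
Definition interleaved d e : bool :=
  ((dsrc d < dsrc e < dtgt d) && (dtgt d < dtgt e) ||
   (dsrc e < dsrc d < dtgt e) && (dtgt e < dtgt d))%N.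

Lemma interleavedC d e : interleaved d e = interleaved e d.
Proof. by rewrite /interleaved orbC. Qed.

Lemma interleavedxx d : interleaved d d = false.
Proof. by rewrite /interleaved; lia. Qed.

Definition noncrossing T := forall d e, d \in T -> e \in T -> ~~ interleaved d e.

Definition maximal_noncrossing T := noncrossing T /\
  forall d, (forall e, e \in T -> ~~ interleaved d e) -> d \in T.

(** The sides are added as the leaves of the recursion and the closing side from [0] to [n.+2] as
    its root. *)
Definition edge T p q : bool := ((p < q < n.+3) &&
  [|| [exists d in T, (dsrc d == p) && (dtgt d == q)], q == p.+1
    | (p == 0) && (q == n.+2)])%N.

Lemma edgeP T p q : edge T p q -> [/\ (p < q < n.+3)%N &
  (exists2 d, d \in T & dsrc d = p /\ dtgt d = q) \/ q = p.+1 \/ p = 0%N /\ q = n.+2].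
Proof.
case/andP=> pq /or3P[/existsP[d /and3P[dT /eqP dp /eqP dq]]|/eqP q1|/andP[/eqP p0 /eqP qn]].
- by split => //; left; exists d.
- by split => //; right; left.
- by split => //; right; right.
Qed.

Lemma edge_diag T d : d \in T -> edge T (dsrc d) (dtgt d).
Proof.
move=> dT; have [h1 h2 _] := diagP d; apply/andP; split; first by lia.
by apply/or3P; constructor 1; apply/existsP; exists d; rewrite dT !eqxx.
Qed.

Lemma edge_side T p : (p < n.+2)%N -> edge T p p.+1.
Proof. by move=> pn; rewrite /edge eqxx orbT; lia. Qed.

Lemma edge_root T : edge T 0 n.+2.
Proof. by rewrite /edge !eqxx !orbT; lia. Qed.

Lemma edge_noncross T p p' q q' : noncrossing T -> (p < p' < q)%N -> (q < q')%N ->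
  edge T p q -> edge T p' q' -> False.
Proof.
move=> ncT pp'q qq' /edgeP[h1 [[d dT [dp dq]]|h2]] /edgeP[h3 [[e eT [ep eq]]|h4]]; try lia.
by have := ncT d e dT eT; rewrite /interleaved; lia.
Qed.

(** With [t] the last neighbour of [p] before [q], a diagonal of [T] crossing [(t, q)] would cross
    [(p, q)] or [(p, t)], or give [p] a later neighbour. So [(t, q)] is an edge by maximality. *)
Lemma edge_dissection T : maximal_noncrossing T -> dissection n.+3 (fun p q => edge T p q).
Proof.
move=> [ncT maxT]; split.
- by move=> p q /edgeP[].
- by move=> *; apply: (edge_noncross ncT); eassumption.
move=> p q Epq pq1; have [pqn _] := edgeP Epq.
(* The third vertex is the last one before [q] that is joined to [p]. *)
pose P t := (p < t < q)%N && edge T p t.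
have exP : exists t, P t.
  by exists p.+1; rewrite /P edge_side; lia.
have ubP t : P t -> (t <= q)%N by rewrite /P; lia.
case: (ex_maxnP exP ubP) => t /andP[ptq Ept] tmax; exists t; split => //.
apply: contraT => nEtq.
have [d [dt dq]] : exists d, dsrc d = t /\ dtgt d = q.
  apply: diag_exists; last by lia.
  have : q != t.+1 by apply: contraNneq nEtq => ->; apply: edge_side; lia.
  by lia.
have dT : d \in T.
  apply: maxT => e eT; apply/negP => cde.
  have Ee := edge_diag eT.
  have [h1|h1] : (dsrc e <= p)%N \/ (p < dsrc e)%N by lia.
    have [h2|h2] : (dsrc e < p)%N \/ (dsrc e = p)%N by lia.
      move: cde; rewrite /interleaved dt dq => cde.
      by apply: (edge_noncross ncT _ _ Ee Epq); lia.
    have := tmax (dtgt e); rewrite /P -h2 Ee andbT h2.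
    by move: cde; rewrite /interleaved dt dq; lia.
  move: cde; rewrite /interleaved dt dq => /orP[] cde.
    by case: (@edge_noncross T p (dsrc e) q (dtgt e) ncT _ _ Epq Ee); lia.
  by case: (@edge_noncross T p (dsrc e) t (dtgt e) ncT _ _ Ept Ee); lia.
by move: nEtq; rewrite -dt -dq edge_diag.
Qed.

(** * Non-crossing weights on diagonals and their coordinates *)

Section Weights.
Variable R : realFieldType.
Implicit Types c : D -> R.

Definition noncrossing_weight c := (forall d, 0 <= c d) /\
  forall d e, c d != 0 -> c e != 0 -> ~~ interleaved d e.

Definition weight_coord c e := \sum_(d | interleaved d e) c d - c e.

Definition joins d p q := ((dsrc d == p) && (dtgt d == q) || (dsrc d == q) && (dtgt d == p))%N.

Definition extension c p q := \sum_(d | joins d p q) c d.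

Lemma joinsC d p q : joins d p q = joins d q p.
Proof. by rewrite /joins orbC. Qed.

Lemma extension_diag c d : extension c (dsrc d) (dtgt d) = c d.
Proof.
rewrite /extension (big_pred1 d) // => e; apply/idP/eqP => [|->]; last by rewrite /joins !eqxx.
rewrite /joins; have [h1 _ _] := diagP d; have [h2 _ _] := diagP e => h.
by apply: diag_inj; lia.
Qed.

Lemma extension_neq0 c p q : extension c p q != 0 -> exists2 d, joins d p q & c d != 0.
Proof.
move=> nz; have [/existsP[d /andP[jd cd]]|] := boolP [exists d, joins d p q && (c d != 0)].
  by exists d.
rewrite negb_exists => /forallP h; case/negP: nz; apply/eqP/big1 => d jd.
by have := h d; rewrite jd negbK => /eqP.
Qed.

Lemma extension_lamination c : noncrossing_weight c -> lamination n.+3 (extension c).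
Proof.
move=> [c0 ncc]; split.
- by move=> p q; apply: eq_bigl => d; apply: joinsC.
- by move=> p q; apply: sumr_ge0.
- move=> p; apply/eqP/contraT => /extension_neq0[d + _].
  by have [h1 _ _] := diagP d; rewrite /joins; lia.
- move=> p p' q q' h1 h2 /extension_neq0[d jd cd] /extension_neq0[e je ce].
  have := ncc d e cd ce; move: jd je; rewrite /joins /interleaved.
  by have [? _ _] := diagP d; have [? _ _] := diagP e; lia.
Qed.

Lemma extension_coord c e : dcoord n.+3 (extension c) (dsrc e) (dtgt e) = weight_coord c e.
Proof.
rewrite /dcoord extension_diag; congr (_ - _).
rewrite /crossing /out pair_big_dep /= (exchange_big_dep predT) //=.
rewrite [RHS]big_mkcond; apply: eq_bigr => d _.
have [d1 d2 _] := diagP d; have [e1 e2 _] := diagP e.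
have dm : (dsrc d < n.+3)%N by lia.
pose x : 'I_n.+3 := Ordinal dm; pose y : 'I_n.+3 := Ordinal d2.
(* A diagonal crossing [e] is counted exactly once, by the pair whose first entry is its end
   strictly between the ends of [e]. *)
have [h|h] := boolP ((dsrc e < dsrc d < dtgt e) && (dtgt e < dtgt d))%N.
  rewrite ifT; last by rewrite /interleaved; lia.
  rewrite (big_pred1 (x, y)) // => -[i j] /=; rewrite /joins -pair_eqE /= -!val_eqE /=; lia.
have [h'|h'] := boolP ((dsrc d < dsrc e < dtgt d) && (dtgt d < dtgt e))%N.
  rewrite ifT; last by rewrite /interleaved; lia.
  rewrite (big_pred1 (y, x)) // => -[i j] /=; rewrite /joins -pair_eqE /= -!val_eqE /=; lia.
rewrite ifF; last by rewrite /interleaved; lia.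
by rewrite big_pred0 // => -[i j] /=; rewrite /joins; lia.
Qed.

(** For weights on diagonals all sides, the closing one included, have coordinate [0]. So agreement
    on [T] is agreement on all edges, and [dissection_unique] applies at the root. *)
Theorem weight_unique T c c' : maximal_noncrossing T ->
  noncrossing_weight c -> noncrossing_weight c' ->
  (forall e, e \in T -> weight_coord c e = weight_coord c' e) -> c =1 c'.
Proof.
move=> mT ncc ncc' eqT d.
have lc := extension_lamination ncc; have lc' := extension_lamination ncc'.
have coord0 w : noncrossing_weight w -> forall p q, (p < q < n.+3)%N ->
    q = p.+1 \/ p = 0%N /\ q = n.+2 -> dcoord n.+3 (extension w) p q = 0.
  move=> ncw p q pqn h; rewrite /dcoord.
  have -> : extension w p q = 0.
    by apply: big1 => e; have [? ? ?] := diagP e; rewrite /joins; lia.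
  rewrite subr0; case: h => [->|[-> ->]]; first exact: crossing_side.
  rewrite /crossing big1 // => v _; rewrite /out big_pred0 // => u.
  by have := ltn_ord u; lia.
have eqE p q : edge T p q ->
    dcoord n.+3 (extension c) p q = dcoord n.+3 (extension c') p q.
  case/edgeP=> pqn [[e eT [<- <-]]|h]; first by rewrite !extension_coord eqT.
  by rewrite !coord0.
have [_ /(_ (dsrc d) (dtgt d))] :=
  dissection_unique (edge_dissection mT) lc lc' eqE (edge_root T).
by have [h1 h2 _] := diagP d; rewrite !extension_diag; apply; lia.
Qed.

Theorem weight_exist T (x : D -> R) : maximal_noncrossing T ->
  exists2 c, noncrossing_weight c & forall e, e \in T -> weight_coord c e = x e.
Proof.
move=> mT; pose y p q := \sum_(d in T | joins d p q) x d.
have y_side p q : q = p.+1 \/ p = 0%N /\ q = n.+2 -> y p q = 0.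
  by move=> h; apply: big1 => e /andP[_]; have [? ? ?] := diagP e; rewrite /joins; lia.
have y_diag d : d \in T -> y (dsrc d) (dtgt d) = x d.
  move=> dT; rewrite /y (big_pred1 d) // => e; apply/idP/eqP => [|->]; last first.
    by rewrite dT /joins !eqxx.
  rewrite /joins; have [h1 _ _] := diagP d; have [h2 _ _] := diagP e => h.
  by apply: diag_inj; lia.
have [|s [ls sup co]] := dissection_exist (edge_dissection mT) _ (edge_root T) (x := y).
  by move=> p; apply: y_side; left.
(* Coordinate [0] at the root means that nothing crosses the closing side, so no weight stays
   pending at the extra vertex [n.+3], which can then be dropped. *)
have root : (0 < n.+2 < n.+4)%N by lia.
have co0 : dcoord n.+4 s 0 n.+2 = 0 by rewrite co ?edge_root // y_side //; right.
have s_root : s 0%N n.+2 = 0 by rewrite (weightE ls) // co0 oppr0 max_l.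
have cr_root : crossing n.+4 s 0 n.+2 = 0 by rewrite (crossingE ls) // co0 max_l.
have s_top v : (v < n.+3)%N -> s v n.+3 = 0.
  move=> h; apply/eqP/contraT => nz; have [_ [|[_ v0]]] := sup _ _ h nz; first by lia.
  rewrite -(out_top ls sup) // in nz.
  have vm : (v < n.+4)%N by lia.
  have : \sum_(v < n.+4) (if (0 < v < n.+2)%N then out n.+4 s 0 n.+2 v else 0) = 0.
    by rewrite -big_mkcond.
  pose f v := if (0 < v < n.+2)%N then out n.+4 s 0 n.+2 v else 0.
  have f0 u : 0 <= f u by rewrite /f; case: ifP => // _; apply: out_ge0 ls _ _ _.
  by move/(psum_eq0 f0) => /(_ _ vm); rewrite /f v0 => z; rewrite z eqxx in nz.
pose c d := s (dsrc d) (dtgt d).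
have ext_s p q : (p < q < n.+3)%N -> extension c p q = s p q.
  move=> pq; have [h|h] : (q = p.+1 \/ p = 0 /\ q = n.+2)%N \/
    ((p.+1 < q < n.+3) /\ (p = 0 -> q < n.+2))%N by lia.
    rewrite /extension big1 => [|e]; last by have [? ? ?] := diagP e; rewrite /joins; lia.
    by case: h => [->|[-> ->]]; rewrite ?(lam_side ls).
  by case: h => h1 h2; have [d [<- <-]] := diag_exists h1 h2; rewrite extension_diag.
exists c.
  split=> [d|d e sd se]; first exact: lam_ge0 ls _ _.
  have [d1 d2 _] := diagP d; have [e1 e2 _] := diagP e.
  apply/negP => /orP[] /andP[h1 h2].
    by apply: (lam_noncross ls h1 _ sd se); lia.
  by apply: (lam_noncross ls h1 _ se sd); lia.
move=> e eT; have [e1 e2 _] := diagP e.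
rewrite -(y_diag _ eT) -(co _ _ (edge_diag eT)) //.
rewrite -extension_coord /dcoord ext_s; last by lia.
congr (_ - _); rewrite [RHS]/crossing big_mkcond big_ord_recr /=.
rewrite ifF; last by lia.
rewrite addr0 -big_mkcond; apply: eq_bigr => v /andP[ev ve].
rewrite [RHS]/out big_mkcond big_ord_recr /= s_top // if_same addr0 -big_mkcond.
apply: eq_bigr => u uv; have [h|h] : (v < u)%N \/ (u < v)%N by lia.
  by apply: ext_s; have := ltn_ord u; lia.
rewrite (lam_sym ls) -ext_s; last by have := ltn_ord v; lia.
by apply: eq_bigl => d; apply: joinsC.
Qed.

End Weights.
End Diagonals.

(** * Maximal non-crossing sets have [n] elements *)

Section Cardinality.
Variable n : nat.
Local Notation D := (polygon_diagonal n.+3).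
Implicit Types (d e : D) (T S : {set D}).

(** The positive and negative parts of [c] are non-crossing weights with equal coordinates, hence
    equal; since [c] is their difference, it is [0]. *)
Lemma weight_independent (R : realFieldType) T (c : D -> R) :
  maximal_noncrossing T ->
  (forall d e, c d != 0 -> c e != 0 -> ~~ interleaved d e) ->
  (forall e, e \in T -> weight_coord c e = 0) -> forall d, c d = 0.
Proof.
move=> mT ncc co d.
pose c1 d := Num.max (c d) 0; pose c2 d := Num.max (- c d) 0.
have c12 e : c e = c1 e - c2 e.
  by rewrite /c1 /c2; case: (lerP (c e) 0) => ?; case: (lerP (- c e) 0) => ?; lra.
have nc1 : noncrossing_weight c1.
  split=> [e|e e']; first by rewrite le_max lexx orbT.
  by move=> h1 h2; apply: ncc; [move: h1|move: h2]; apply: contra_neq => h; rewrite /c1 h maxxx.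
have nc2 : noncrossing_weight c2.
  split=> [e|e e']; first by rewrite le_max lexx orbT.
  by move=> h1 h2; apply: ncc; [move: h1|move: h2]; apply: contra_neq => h; rewrite /c2 h oppr0 maxxx.
have eq12 : c1 =1 c2.
  apply: (weight_unique mT nc1 nc2) => e /co; rewrite /weight_coord c12.
  under eq_bigr do rewrite c12.
  by rewrite sumrB; lra.
by rewrite c12 eq12 subrr.
Qed.

Lemma maximal_extension S : noncrossing S ->
  exists2 T, maximal_noncrossing T & S \subset T.
Proof.
move=> ncS; pose P T := [forall d in T, forall e in T, ~~ interleaved d e].
have PP T : reflect (noncrossing T) (P T).
  apply: (iffP idP) => [/forall_inP h d e dT eT|h].
    by have /forall_inP := h d dT; apply.
  by apply/forall_inP => d dT; apply/forall_inP => e; apply: h.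
have [T /maxsetP[/PP ncT maxT] ST] := maxset_exists (introT (PP S) ncS).
exists T => //; split => // d dnc.
rewrite -(maxT (d |: T)%SET) ?finset.setU11 ?finset.subsetUr //; apply/PP => e f.
move=> /finset.setU1P[->|eT] /finset.setU1P[->|fT]; rewrite ?interleavedxx //; last exact: ncT.
  exact: dnc.
by rewrite interleavedC dnc.
Qed.

(** The coordinates at [T] of the unit weights on the elements of [S] form a matrix whose rows are
    independent by [weight_independent]. *)
Lemma maximal_card_le S T : maximal_noncrossing S -> maximal_noncrossing T ->
  (#|S| <= #|T|)%N.
Proof.
move=> [ncS _] mT.
pose A : 'M[rat]_(#|S|, #|T|) := \matrix_(i, j)
  ((interleaved (enum_val i) (enum_val j))%:R - (enum_val i == enum_val j)%:R).
suff /eqP <- : row_free A by exact: rank_leq_col.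
apply: inj_row_free => v vA0.
pose c d := \sum_(i | enum_val i == d) v 0 i.
have cE i : c (enum_val i) = v 0 i.
  by rewrite /c (big_pred1 i) // => j; rewrite (inj_eq enum_val_inj).
have cS d : c d != 0 -> d \in S.
  apply: contraNT => dS; rewrite /c big_pred0 // => i.
  by apply/negP => /eqP e; move: dS; rewrite -e enum_valP.
apply/rowP => i; rewrite mxE -cE; apply: (weight_independent mT).
  by move=> d e /cS dS /cS eS; apply: ncS.
move=> e eT; have /rowP/(_ (enum_rank_in eT e)) := vA0.
rewrite !mxE => <-.
rewrite /weight_coord (bigID (mem S)) /= [X in _ + X - _]big1 ?addr0; last first.
  by move=> d /andP[_ dS]; apply/eqP; apply: contraNT dS; apply: cS.
transitivity (\sum_(d in S) c d * ((interleaved d e)%:R - (d == e)%:R)).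
  rewrite [RHS](eq_bigr (fun d => c d * (interleaved d e)%:R - c d * (d == e)%:R)); last first.
    by move=> d _; rewrite mulrBr.
  rewrite sumrB; congr (_ - _).
    rewrite (eq_bigl (fun d => (d \in S) && interleaved d e)) => [|d]; last by rewrite andbC.
    by rewrite big_mkcondr; apply: eq_bigr => d _; case: ifP; rewrite ?mulr1 ?mulr0.
  have [eS|eS] := boolP (e \in S).
    rewrite (bigD1 e) //= eqxx mulr1 big1 ?addr0 // => d /andP[_ /negbTE ->].
    by rewrite mulr0.
  rewrite big1 => [|d dS]; first by apply/eqP; apply: contraNT eS; apply: cS.
  by case: eqP => [de|]; [rewrite -de dS in eS|rewrite mulr0].
rewrite big_enum_val /=; apply: eq_bigr => j _.
by rewrite cE mxE enum_rankK_in.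
Qed.

Lemma star_maximal : maximal_noncrossing [set d : D | dsrc d == 0%N]%SET.
Proof.
split=> [d e|d dnc]; first by rewrite !inE /interleaved => /eqP -> /eqP ->; lia.
rewrite inE; apply: contraT => d0; have [d1 d2 _] := diagP d.
(* A diagonal that avoids the vertex [0] crosses the one from [0] to the vertex after its source. *)
have [e [e1 e2]] : exists e : D, dsrc e = 0%N /\ dtgt e = (dsrc d).+1.
  by apply: diag_exists; lia.
by have := dnc e; rewrite inE e1 eqxx /interleaved e1 e2 => /(_ isT); lia.
Qed.

Lemma star_card : #|[set d : D | dsrc d == 0%N]%SET| = n.
Proof.
rewrite cardE -(size_map (@dtgt n)) -[RHS](size_iota 2).
apply/perm_size/uniq_perm; rewrite ?iota_uniq //.
  rewrite map_inj_in_uniq ?enum_uniq // => d e.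
  by rewrite !mem_enum !inE => /eqP d0 /eqP e0; apply: diag_inj; rewrite d0 e0.
move=> i; rewrite mem_iota; apply/mapP/idP => [[d]|h].
  by rewrite mem_enum inE => /eqP d0 ->; have [? ? ?] := diagP d; lia.
have [||d [d1 d2]] := @diag_exists n 0 i; [by lia|by lia|].
by exists d => //; rewrite mem_enum inE d1.
Qed.

Lemma maximal_card T : maximal_noncrossing T -> #|T| = n.
Proof.
move=> mT; have le1 := maximal_card_le mT star_maximal.
have le2 := maximal_card_le star_maximal mT.
by rewrite star_card in le1 le2; apply/eqP; rewrite eqn_leq le1 le2.
Qed.

(** A non-crossing set with [n] elements lies in a maximal one, which also has [n] elements, so the
    two coincide. *)
Lemma maximalP T : maximal_noncrossing T <-> #|T| = n /\ noncrossing T.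
Proof.
split=> [mT|[cT ncT]]; first by split; [exact: maximal_card|case: mT].
have [T' mT' TT'] := maximal_extension ncT.
suff -> : T = T' by [].
by apply/eqP; rewrite eqEcard TT' cT (maximal_card mT') leqnn.
Qed.

End Cardinality.

(** * Crossing diagonals of a convex polygon *)

Section ConvexPolygon.
Variables (R : realType) (n : nat) (P : 'I_n.+3 -> 'rV[R]_2).
Hypothesis hP : convex_polygon P.
Local Notation D := (polygon_diagonal n.+3).
Implicit Types a b c f x : 'rV[R]_2.

Lemma orientation_cycle a b c : orientation a b c = orientation b c a.
Proof. by rewrite /orientation; ring. Qed.

Lemma orientation_swap a b c : orientation b a c = - orientation a b c.
Proof. by rewrite /orientation; ring. Qed.

Lemma orientation_segment a b c f (t : R) :
  orientation a b ((1 - t) *: c + t *: f) =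
  (1 - t) * orientation a b c + t * orientation a b f.
Proof. by rewrite /orientation !mxE; ring. Qed.

(** The three-term Grassmann-Plücker relation. *)
Lemma orientation_plucker a b c f x :
  orientation x a c * orientation x b f =
  orientation x a b * orientation x c f + orientation x a f * orientation x b c.
Proof. by rewrite /orientation; ring. Qed.

Let Q k : 'rV[R]_2 := P (inord k).
(** The factor given by the first three vertices makes the sign the same for clockwise and
    counterclockwise polygons. *)
Let o i j k := orientation (Q 0) (Q 1) (Q 2) * orientation (Q i) (Q j) (Q k).

Lemma polygon_side i k l : (i < n.+2)%N -> (k < n.+3)%N -> (l < n.+3)%N ->
  k != i -> k != i.+1 -> l != i -> l != i.+1 ->
  0 < orientation (Q i) (Q i.+1) (Q k) * orientation (Q i) (Q i.+1) (Q l).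
Proof.
move=> im km lm ki ki1 li li1.
have -> : Q i.+1 = P (ordS (inord i)).
  congr P; apply: val_inj; rewrite /= !inordK ?modn_small //; lia.
by apply: hP; rewrite -val_eqE /= !inordK ?modn_small //; lia.
Qed.

(** The triangle [i, i.+1, i.+2] belongs to two consecutive sides and carries the sign from one side
    to the next. *)
Lemma side_positive i k : (i < n.+2)%N -> (k < n.+3)%N -> k != i -> k != i.+1 ->
  0 < o i i.+1 k.
Proof.
elim: i k => [|i IHi] k im km ki ki1; first exact: polygon_side.
have h1 := IHi i.+2 ltac:(lia) ltac:(lia) ltac:(lia) ltac:(lia).
have := @polygon_side i.+1 k i im km ltac:(lia) ki ki1 ltac:(lia) ltac:(lia).
rewrite -(orientation_cycle (Q i)) => h2.
move: h1; rewrite /o; set y := orientation (Q i) _ _ in h2 *; set x := orientation _ _ (Q k) in h2 *.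
set z := orientation _ _ _ => h1.
have : 0 < (z * x) * (y * y) by rewrite mulrACA mulr_gt0.
by rewrite pmulr_lgt0 // -expr2 lt0r sqr_ge0 sqrf_eq0; case: eqP h2 => // ->; rewrite mulr0 ltxx.
Qed.

(** Induction on [k]. The Plücker relation seen from [i] for [i.+1, j, k, k.+1] expresses
    [o i j k.+1] by [o i j k] and by triangles on the sides at [i] and at [k], all positive. *)
Lemma triangle_positive i j k : (i < j < k)%N -> (k < n.+3)%N -> 0 < o i j k.
Proof.
elim: k => [|k IHk]; first by lia.
move=> ijk km; have [ji|ij] : j = i.+1 \/ (i.+1 < j)%N by lia.
  by rewrite ji; apply: side_positive; lia.
have side l : (i.+1 < l)%N -> (l < n.+3)%N -> 0 < o i i.+1 l.
  by move=> *; apply: side_positive; lia.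
have next : 0 < o i k k.+1.
  rewrite /o (orientation_cycle (Q i) (Q k)); apply: side_positive; lia.
have [jk|jk] : j = k \/ (j < k)%N by lia.
  by rewrite jk.
have o_ijk : 0 < o i j k by apply: IHk; lia.
have h1 := side k ltac:(lia) ltac:(lia).
have h2 := side k.+1 ltac:(lia) ltac:(lia).
have h3 := side j ltac:(lia) ltac:(lia).
have : o i i.+1 k * o i j k.+1 = o i i.+1 j * o i k k.+1 + o i i.+1 k.+1 * o i j k.
  rewrite /o mulrACA (orientation_plucker _ (Q j) _ (Q k.+1) (Q i)); ring.
have : 0 < o i i.+1 j * o i k k.+1 + o i i.+1 k.+1 * o i j k.
  exact: addr_gt0 (mulr_gt0 h3 next) (mulr_gt0 h2 o_ijk).
by move=> + e; rewrite -e pmulr_rgt0.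
Qed.

Let sg : R := orientation (Q 0) (Q 1) (Q 2).

Lemma orientation_ord (i j k : 'I_n.+3) : (i < j < k)%N ->
  0 < sg * orientation (P i) (P j) (P k).
Proof.
by move=> ijk; have := triangle_positive ijk (ltn_ord k); rewrite /o /Q !inord_val.
Qed.

Lemma orientation_inside (i j k : 'I_n.+3) : (i < k < j)%N ->
  sg * orientation (P i) (P j) (P k) < 0.
Proof.
move=> ikj; rewrite -orientation_cycle orientation_swap mulrN oppr_lt0.
exact: orientation_ord.
Qed.

Lemma orientation_outside (i j k : 'I_n.+3) : (i < j)%N -> (k < i)%N || (j < k)%N ->
  0 < sg * orientation (P i) (P j) (P k).
Proof.
move=> ij /orP[ki|jk]; last by apply: orientation_ord; rewrite ij.
by rewrite -orientation_cycle; apply: orientation_ord; rewrite ki.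
Qed.

Lemma orientation_end1 a b : orientation a b a = 0.
Proof. by rewrite /orientation; ring. Qed.

Lemma orientation_end2 a b : orientation a b b = 0.
Proof. by rewrite /orientation; ring. Qed.

(** Cramer's rule: up to sign, [dl] is the determinant of the two directions, and the parameters of
    the intersection point are quotients of orientations. The opposite signs place them strictly
    between [0] and [1]. *)
Lemma segments_meet a b c f : orientation a b c * orientation a b f < 0 ->
  orientation c f a * orientation c f b < 0 ->
  open_segment a b `&` open_segment c f !=set0.
Proof.
move=> h1 h2; pose dl := orientation a b f - orientation a b c.
have dlE : dl = orientation c f a - orientation c f b by rewrite /dl /orientation; ring.
have cut (x y : R) : x * y < 0 -> 0 < x / (x - y) < 1 /\ x - y != 0.
  move=> xy; have [x0|x0|x0] := ltrgt0P x; last by rewrite x0 mul0r ltxx in xy.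
    have y0 : y < 0 by rewrite pmulr_rlt0 in xy.
    have xy0 : 0 < x - y by lra.
    by rewrite divr_gt0 // ltr_pdivrMr // mul1r; split; [lra|rewrite gt_eqF].
  have y0 : 0 < y by rewrite nmulr_rlt0 in xy.
  have xy0 : x - y < 0 by lra.
  rewrite -mulrNN -invrN divr_gt0 ?oppr_gt0 // ltr_pdivrMr ?oppr_gt0 // mul1r.
  by split; [lra|rewrite lt_eqF].
have [t01 dl0] := cut _ _ h2; have [u01 _] := cut _ _ h1.
rewrite -dlE in t01 dl0.
exists ((1 - orientation c f a / dl) *: a + (orientation c f a / dl) *: b); split.
  by exists (orientation c f a / dl).
exists (orientation a b c / (orientation a b c - orientation a b f)) => //.
have -> : orientation a b c - orientation a b f = - dl by rewrite /dl; ring.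
have dl0' : (b 0 0 - a 0 0) * (f 0 1 - c 0 1) - (b 0 1 - a 0 1) * (f 0 0 - c 0 0) != 0.
  by move: dl0; congr (_ != 0); rewrite /dl /orientation; ring.
have dlE' : dl = (b 0 0 - a 0 0) * (f 0 1 - c 0 1) - (b 0 1 - a 0 1) * (f 0 0 - c 0 0).
  by rewrite /dl /orientation; ring.
apply/rowP => i; rewrite !mxE /orientation dlE'.
have [->|->] : i = 0 \/ i = 1.
  by case: i => -[|[|//]] h; [left|right]; apply: val_inj.
  by field; rewrite ?oppr_eq0.
by field; rewrite ?oppr_eq0.
Qed.

Lemma interleaved_cross (d e : D) : interleaved d e -> cross P d e.
Proof.
rewrite /interleaved => h; rewrite /cross /diagonal_interior.
have [d1 _ _] := diagP d; have [e1 _ _] := diagP e.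
have opp (x y : R) : 0 < sg * x -> sg * y < 0 -> x * y < 0.
  move=> h1 h2; have : (sg * x) * (sg * y) < 0 by rewrite pmulr_rlt0.
  rewrite mulrACA pmulr_rlt0 // -expr2 lt0r sqr_ge0 sqrf_eq0 andbT.
  by apply: contraTneq h1 => ->; rewrite mul0r ltxx.
rewrite /dsrc /dtgt in h d1 e1.
apply: segments_meet.
  case/orP: h => h; [rewrite mulrC|]; apply: opp.
  - by apply: orientation_outside; lia.
  - by apply: orientation_inside; lia.
  - by apply: orientation_outside; lia.
  - by apply: orientation_inside; lia.
case/orP: h => h; [|rewrite mulrC]; apply: opp.
- by apply: orientation_outside; lia.
- by apply: orientation_inside; lia.
- by apply: orientation_outside; lia.
- by apply: orientation_inside; lia.
Qed.

(** If [d] and [e] are not interleaved, both ends of [e] lie weakly on one side of the line through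
    [d]. A common interior point then puts both on this line, where [d] has the only vertices, so
    [d = e]. *)
Lemma cross_interleaved (d e : D) : d != e -> cross P d e -> interleaved d e.
Proof.
move=> de [x [[t t01 tx] [u u01 ux]]]; apply: contraT => nde; exfalso.
have /andP[u0 u1] : 0 < u < 1 := u01.
have [d1 _ _] := diagP d; have [e1 _ _] := diagP e.
have zero : (1 - u) * (sg * orientation (P (val d).1) (P (val d).2) (P (val e).1)) +
    u * (sg * orientation (P (val d).1) (P (val d).2) (P (val e).2)) = 0.
  rewrite [LHS](_ : _ = sg *
    ((1 - u) * orientation (P (val d).1) (P (val d).2) (P (val e).1) +
     u * orientation (P (val d).1) (P (val d).2) (P (val e).2))); last by ring.
  rewrite -orientation_segment ux -tx orientation_segment.
  by rewrite orientation_end1 orientation_end2 !mulr0 addr0 mulr0.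
have pos (y z : R) : 0 <= y -> 0 <= z -> (1 - u) * y + u * z = 0 -> y = 0 /\ z = 0.
  move=> y0 z0; have u2 : 0 < 1 - u by rewrite subr_gt0.
  move/eqP; rewrite paddr_eq0 ?mulr_ge0 //; try exact: ltW.
  by rewrite !mulf_eq0 (gt_eqF u2) (gt_eqF u0) /= => /andP[/eqP -> /eqP ->].
have neg (y z : R) : y <= 0 -> z <= 0 -> (1 - u) * y + u * z = 0 -> y = 0 /\ z = 0.
  move=> y0 z0 h; case: (pos (- y) (- z)); rewrite ?oppr_ge0 //; last first.
    by move=> /eqP + /eqP; rewrite !oppr_eq0 => /eqP -> /eqP ->.
  by rewrite !mulrN -opprD h oppr0.
rewrite /interleaved /dsrc /dtgt in nde d1 e1.
have at_end (k : 'I_n.+3) : sg * orientation (P (val d).1) (P (val d).2) (P k) = 0 ->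
    k = (val d).1 \/ k = (val d).2.
  move=> z; have [h|[h|[h|h]]] : ((k == (val d).1 :> nat) \/ (k == (val d).2 :> nat) \/
    ((val d).1 < k < (val d).2) \/ ((k < (val d).1) || ((val d).2 < k)))%N by lia.
  - by left; apply/val_inj/eqP.
  - by right; apply/val_inj/eqP.
  - by have := orientation_inside h; rewrite z ltxx.
  - by have := @orientation_outside (val d).1 (val d).2 k ltac:(lia) h; rewrite z ltxx.
have inside_le (k : 'I_n.+3) : ((val d).1 <= k <= (val d).2)%N ->
    sg * orientation (P (val d).1) (P (val d).2) (P k) <= 0.
  move=> h; have [/eqP h1|[/eqP h1|h1]] : ((k == (val d).1 :> nat) \/ (k == (val d).2 :> nat) \/
    ((val d).1 < k < (val d).2))%N by lia.
  - by rewrite (val_inj h1) orientation_end1 mulr0.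
  - by rewrite (val_inj h1) orientation_end2 mulr0.
  - exact: ltW (orientation_inside h1).
have outside_ge (k : 'I_n.+3) : ((k <= (val d).1) || ((val d).2 <= k))%N ->
    0 <= sg * orientation (P (val d).1) (P (val d).2) (P k).
  move=> h; have [/eqP h1|[/eqP h1|h1]] : ((k == (val d).1 :> nat) \/ (k == (val d).2 :> nat) \/
    ((k < (val d).1) || ((val d).2 < k)))%N by lia.
  - by rewrite (val_inj h1) orientation_end1 mulr0.
  - by rewrite (val_inj h1) orientation_end2 mulr0.
  - by apply: ltW; apply: orientation_outside => //; lia.
have [z1 z2] : sg * orientation (P (val d).1) (P (val d).2) (P (val e).1) = 0 /\
    sg * orientation (P (val d).1) (P (val d).2) (P (val e).2) = 0.
  have [[h1 h2]|[h1 h2]] :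
    (((val d).1 <= (val e).1 <= (val d).2) /\ ((val d).1 <= (val e).2 <= (val d).2) \/
     (((val e).1 <= (val d).1) || ((val d).2 <= (val e).1)) /\
     (((val e).2 <= (val d).1) || ((val d).2 <= (val e).2)))%N by lia.
    by apply: neg => //; apply: inside_le.
  by apply: pos => //; apply: outside_ge.
case/eqP: de; apply: diag_inj; rewrite /dsrc /dtgt.
  by case: (at_end _ z1) (at_end _ z2) e1 => -> // [] ->; lia.
by case: (at_end _ z1) (at_end _ z2) e1 => -> // [] ->; lia.
Qed.

End ConvexPolygon.

(** * The fan *)

Lemma scalar_of_free (R : fieldType) (V : vectType R) k (X : k.-tuple V) (y : 'I_k -> R) :
  free X -> exists f : {scalar V}, forall i : 'I_k, f X`_i = y i.
Proof.
move=> frX; pose f x := \sum_i y i * coord X i x.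
have lin_f : scalar f.
  move=> a u v; rewrite /f mulr_sumr -big_split /=.
  by apply: eq_bigr => i _; rewrite linearP /=; ring.
exists (HB.pack f (GRing.isLinear.Build R V R^o *%R f lin_f) : {scalar V}) => i /=.
rewrite /f (bigD1 i) //= coord_free // eqxx mulr1 big1 ?addr0 // => j ji.
by rewrite coord_free // eq_sym (negbTE ji) mulr0.
Qed.

Lemma maximal_triangulation (R : realType) n (P : 'I_n.+3 -> 'rV[R]_2) T :
  convex_polygon P -> triangulation P T <-> maximal_noncrossing T.
Proof.
move=> hP; rewrite maximalP; split=> -[cT ncT]; split => // d e dT eT.
  have [->|de] := eqVneq d e; first by rewrite interleavedxx.
  by apply/negP => /(interleaved_cross hP); apply: ncT.
by move=> de /(cross_interleaved hP de); apply/negP/ncT.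
Qed.

Section Fan.
Variables (R : realType) (n : nat) (P : 'I_n.+3 -> 'rV[R]_2).
Hypothesis hP : convex_polygon P.
Local Notation D := (polygon_diagonal n.+3).
Variables (delta : n.-tuple D) (V : vectType R) (alpha : n.-tuple V).
Hypotheses (uniq_delta : uniq delta) (alpha_basis : basis_of fullv alpha).
Hypothesis max_delta : maximal_noncrossing [set d in delta]%SET.
Implicit Types (d e : D) (S T : {set D}) (c : D -> R).

Local Notation v := (diagonal_vector P delta alpha).

Definition combination c : V := \sum_d c d *: v d.

Lemma alpha_free : free alpha.
Proof. exact: basis_free alpha_basis. Qed.

Lemma tnth_alpha i : tnth alpha i = alpha`_i.
Proof. exact: tnth_nth. Qed.

Lemma mem_delta i : tnth delta i \in [set d in delta]%SET.
Proof. by rewrite inE mem_tnth. Qed.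

(** One formula covers both cases of the definition: a diagonal of the seed crosses no other one of
    the seed, so only its own term [-1] remains. *)
Lemma diagonal_vectorE d : v d =
  \sum_i ((interleaved d (tnth delta i))%:R - (d == tnth delta i)%:R) *: tnth alpha i.
Proof.
have [ncd _] := max_delta.
rewrite /diagonal_vector; case: pickP => [i /eqP <-|nd].
  rewrite (bigD1 i) //= interleavedxx eqxx sub0r scaleN1r big1 ?addr0 // => j ji.
  rewrite (negbTE (ncd _ _ (mem_delta i) (mem_delta j))).
  rewrite (inj_eq (tuple_uniqP _ uniq_delta)) eq_sym (negbTE ji).
  by rewrite subr0 scale0r.
rewrite big_mkcond; apply: eq_bigr => i _.
have dn : d != tnth delta i by rewrite eq_sym nd.
rewrite (negbTE dn) subr0; case: asboolP => [/(cross_interleaved hP dn) ->|nc].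
  by rewrite scale1r.
case: (boolP (interleaved d (tnth delta i))) => [/(interleaved_cross hP)//|_].
by rewrite scale0r.
Qed.

Lemma combinationE c :
  combination c = \sum_i weight_coord c (tnth delta i) *: tnth alpha i.
Proof.
rewrite /combination; under eq_bigr do rewrite diagonal_vectorE scaler_sumr.
rewrite exchange_big; apply: eq_bigr => i _.
under eq_bigr do rewrite scalerA mulrBr scalerBl.
rewrite sumrB /weight_coord scalerBl; congr (_ - _).
  rewrite scaler_suml [RHS]big_mkcond; apply: eq_bigr => d _.
  by case: ifP => _; rewrite ?mulr1 ?mulr0 ?scale0r.
rewrite (bigD1 (tnth delta i)) //= eqxx mulr1 big1 ?addr0 // => d /negbTE ->.
by rewrite mulr0 scale0r.
Qed.

Lemma combination_coord c i : coord alpha i (combination c) = weight_coord c (tnth delta i).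
Proof.
rewrite combinationE; under eq_bigr do rewrite tnth_alpha.
by rewrite coord_sum_free // alpha_free.
Qed.

Lemma combination_eq_coord c c' : combination c = combination c' ->
  forall e, e \in [set d in delta]%SET -> weight_coord c e = weight_coord c' e.
Proof.
move=> e12 e; rewrite inE => /tnthP[i ->].
by rewrite -!combination_coord e12.
Qed.

Lemma combination_inj c c' : noncrossing_weight c -> noncrossing_weight c' ->
  combination c = combination c' -> c =1 c'.
Proof.
by move=> ncc ncc' /combination_eq_coord; apply: (weight_unique max_delta).
Qed.

Lemma combination_surj x : exists2 c, noncrossing_weight c & combination c = x.
Proof.
pose y d := if [pick i | tnth delta i == d] is Some i then coord alpha i x else 0.
have [c ncc cy] := weight_exist y max_delta.
exists c => //; rewrite combinationE [RHS](coord_basis alpha_basis (memvf x)).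
apply: eq_bigr => i _; rewrite tnth_alpha cy ?mem_delta // /y.
case: pickP => [j|/(_ i)]; last by rewrite eqxx.
by rewrite (inj_eq (tuple_uniqP _ uniq_delta)) => /eqP ->.
Qed.

Lemma combination_independent c :
  (forall d e, c d != 0 -> c e != 0 -> ~~ interleaved d e) ->
  combination c = 0 -> forall d, c d = 0.
Proof.
move=> ncc c0; apply: (weight_independent max_delta ncc) => e.
by rewrite inE => /tnthP[i ->]; rewrite -combination_coord c0 linear0.
Qed.

Definition generators S : seq V := triangulation_generators P delta alpha S.

Lemma generators_sum S (c : nat -> R) :
  \sum_(i < size (generators S)) c i *: (generators S)`_i =
  combination (fun d => if d \in S then c (index d (enum S)) else 0).
Proof.
rewrite /combination [RHS](bigID (mem S)) /= [X in _ + X]big1 ?addr0; last first.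
  by move=> d /negbTE ->; rewrite scale0r.
rewrite -[RHS]big_enum [RHS]big_tnth /generators /triangulation_generators size_map.
apply: eq_bigr => i _.
set d := tnth _ i; have dS : d \in S by rewrite -mem_enum mem_tnth.
have dE : d = nth d (enum S) i by exact: tnth_nth.
have iE : index d (enum S) = i by rewrite {1}dE index_uniq ?enum_uniq.
by rewrite dS (nth_map d) // -dE iE.
Qed.

(** Coefficients are weights on all diagonals that vanish off [S], so that the cones of different
    sets can be compared. *)
Definition set_cone S : set V := [set x | exists c,
  [/\ forall d, 0 <= c d, forall d, d \notin S -> c d = 0 & x = combination c]].

Lemma set_coneE S : set_cone S = cone (generators S).
Proof.
apply/seteqP; split=> x.
  move=> [c [c0 cS ->]]; pose a i := if [pick d in S | index d (enum S) == i] is Some d then c d else 0.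
  exists a => [i|]; first by rewrite /a; case: pickP.
  rewrite generators_sum; apply: eq_bigr => d _; case: ifPn => [dS|/cS ->//].
  rewrite /a; case: pickP => [e /andP[eS /eqP ie]|/(_ d)]; last by rewrite dS eqxx.
  by rewrite -(nth_index d (_ : e \in enum S)) ?mem_enum // ie nth_index ?mem_enum.
move=> [a a0 ->]; rewrite generators_sum.
exists (fun d => if d \in S then a (index d (enum S)) else 0); split => // d.
  by case: ifP.
by move=> /negbTE ->.
Qed.

Lemma generators_free S : noncrossing S -> free (generators S).
Proof.
move=> ncS; apply/(@freeP _ _ _ (in_tuple (generators S))) => k k0 i.
pose a j := if insub j is Some i then k i else 0.
have aE (j : 'I_(size (generators S))) : a j = k j by rewrite /a valK.
have : combination (fun d => if d \in S then a (index d (enum S)) else 0) = 0.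
  by rewrite -generators_sum -[RHS]k0; apply: eq_bigr => j _; rewrite aE.
move/combination_independent => c0.
have [d dS dE] : exists2 d, d \in S & index d (enum S) = i.
  have im : (i < size (enum S))%N by rewrite -(size_map v).
  pose d := tnth (in_tuple (enum S)) (Ordinal im).
  exists d; first by rewrite -mem_enum mem_tnth.
  by rewrite /d (tnth_nth d) index_uniq ?enum_uniq.
have aS e : (if e \in S then a (index e (enum S)) else 0) != 0 -> e \in S.
  by apply: contraNT => /negbTE ->.
have := c0 (fun e e' ce ce' => ncS e e' (aS e ce) (aS e' ce')) d.
by rewrite dS dE aE.
Qed.

Lemma set_cone_simplicial S : noncrossing S -> simplicial_cone (set_cone S).
Proof. by move=> ncS; exists (generators S); [exact: generators_free|exact: set_coneE]. Qed.

Lemma mem_set_cone S d : d \in S -> set_cone S (v d).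
Proof.
move=> dS; exists (fun e => (e == d)%:R); split => [e|e|].
- exact: ler0n.
- by case: eqP => // ->; rewrite dS.
rewrite /combination (bigD1 d) //= eqxx scale1r big1 ?addr0 // => e /negbTE ->.
by rewrite scale0r.
Qed.

Lemma scalar_combination (f : {scalar V}) c :
  f (combination c) = \sum_d c d * f (v d).
Proof. by rewrite /combination linear_sum; apply: eq_bigr => d _; rewrite linearZ. Qed.

(** A functional that is nonnegative on the cone vanishes at a point only if it vanishes on each
    generator occurring there. Conversely the generators are free, so some functional is [0] on
    those of [S'] and [1] on the others. *)
Lemma face_set_cone S F : noncrossing S ->
  face (set_cone S) F <-> exists2 S' : {set D}, S' \subset S & F = set_cone S'.
Proof.
move=> ncS; split=> [[f f0 ->]|[S' S'S ->]].
  exists [set d in S | f (v d) == 0]%SET.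
    by apply/fintype.subsetP => d; rewrite inE => /andP[].
  apply/seteqP; split=> x.
    move=> [[c [c0 cS xE]] /= fx]; exists c; split => // d.
    rewrite inE; have [dS /= fd|dS _] := boolP (d \in S); last exact: cS.
    move: fx; rewrite xE scalar_combination => /eqP; rewrite psumr_eq0.
      by move=> /allP/(_ d (mem_index_enum _)) /=; rewrite mulf_eq0 (negbTE fd) orbF => /eqP.
    move=> e _; have [eS|eS] := boolP (e \in S); last by rewrite cS ?mul0r.
    by rewrite mulr_ge0 // f0 //; apply: mem_set_cone.
  move=> [c [c0 cS ->]]; split.
    exists c; split => // d dS; apply: cS; rewrite inE; apply: contraNN dS.
    by case/andP.
  rewrite /= scalar_combination big1 // => d _.
  have [|dS] := boolP (d \in [set d in S | f (v d) == 0]%SET).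
    by rewrite inE => /andP[_ /eqP ->]; rewrite mulr0.
  by rewrite cS ?mul0r.
pose X := in_tuple (generators S).
have [f fX] := scalar_of_free (X := X)
  (fun i => \sum_(d in S | index d (enum S) == i) (d \notin S')%:R) (generators_free ncS).
have fv d : d \in S -> f (v d) = (d \notin S')%:R.
  move=> dS; have im : (index d (enum S) < size (generators S))%N.
    by rewrite size_map index_mem mem_enum.
  have := fX (Ordinal im); rewrite /= (nth_map d) ?index_mem ?mem_enum //.
  rewrite nth_index ?mem_enum // => ->; rewrite (big_pred1 d) // => e /=.
  apply/andP/eqP => [[eS /eqP ie]|->]; last by rewrite dS eqxx.
  by rewrite -(nth_index d (_ : e \in enum S)) ?mem_enum // ie nth_index ?mem_enum.
have fc c : (forall d, d \notin S -> c d = 0) ->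
    f (combination c) = \sum_(d in S | d \notin S') c d.
  move=> cS; rewrite scalar_combination (bigID (mem S)) /= [X in _ + X]big1 ?addr0.
    rewrite [RHS]big_mkcondr; apply: eq_bigr => d dS; rewrite fv //.
    by case: ifP; rewrite ?mulr1 ?mulr0.
  by move=> d dS; rewrite cS ?mul0r.
exists f => [x [c [c0 cS ->]]|]; first by rewrite fc //; apply: sumr_ge0.
apply/seteqP; split=> x.
  move=> [c [c0 cS' ->]].
  have cS d : d \notin S -> c d = 0.
    by move=> dS; apply: cS'; apply: contraNN dS; apply: (fintype.subsetP S'S).
  split; first by exists c.
  by rewrite /= fc // big1 // => d /andP[_ /cS'].
move=> [[c [c0 cS ->]] /=]; rewrite fc // => /eqP; rewrite psumr_eq0 // => /allP z.
exists c; split => // d dS'; have [dS|/cS//] := boolP (d \in S).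
by apply/eqP; have := z d (mem_index_enum _); rewrite dS dS'.
Qed.

(** A common point comes from a weight on [S] and one on [S']; these agree by [combination_inj], so
    the support lies in both sets. *)
Lemma set_coneI S S' : noncrossing S -> noncrossing S' ->
  set_cone S `&` set_cone S' = set_cone (S :&: S')%SET.
Proof.
move=> ncS ncS'; apply/seteqP; split=> x.
  move=> [[c [c0 cS xc]] [c' [c'0 cS' xc']]].
  have weight (w : D -> R) (U : {set D}) : noncrossing U -> (forall d, 0 <= w d) ->
      (forall d, d \notin U -> w d = 0) -> noncrossing_weight w.
    move=> ncU w0 wU; split => // d e wd we.
    by apply: ncU; [apply: contraNT wd|apply: contraNT we] => /wU ->.
  have cc' : c =1 c'.
    apply: combination_inj; rewrite -?xc //.
      exact: weight ncS c0 cS.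
    exact: weight ncS' c'0 cS'.
  exists c; split => // d; rewrite finset.in_setI negb_and => /orP[/cS//|/cS'].
  by rewrite cc'.
move=> [c [c0 cS ->]]; split; exists c; split => // d dS; apply: cS.
  by rewrite finset.in_setI negb_and dS.
by rewrite finset.in_setI negb_and dS orbT.
Qed.

Lemma noncrossing_subset S T : S \subset T -> noncrossing T -> noncrossing S.
Proof. by move=> /fintype.subsetP ST ncT d e dS eS; apply: ncT; apply: ST. Qed.

(** Every non-crossing set extends to a triangulation, so its cone is a face of a cone of the
    fan. *)
Lemma triangulation_fanE C :
  triangulation_fan P delta alpha C <-> exists2 S, noncrossing S & C = set_cone S.
Proof.
split=> [[T /(maximal_triangulation T hP)[ncT _]]|[S ncS ->]].
  rewrite /triangulation_cone -set_coneE => /(face_set_cone _ ncT)[S ST ->].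
  by exists S => //; apply: noncrossing_subset ncT.
have [T mT ST] := maximal_extension ncS.
exists T; first exact/maximal_triangulation.
rewrite /triangulation_cone -set_coneE; apply/face_set_cone; first by case: mT.
by exists S.
Qed.

Lemma triangulation_fan_simplicial : simplicial_fan (triangulation_fan P delta alpha).
Proof.
split.
- apply: (@sub_finite_set _ _ (set_cone @` [set: {set D}])); last first.
    exact/finite_image/finite_finset.
  by move=> C /triangulation_fanE[S _ ->]; exists S.
- by move=> C /triangulation_fanE[S ncS ->]; apply: set_cone_simplicial.
- move=> C F /triangulation_fanE[S ncS ->] /(face_set_cone _ ncS)[S' S'S ->].
  by apply/triangulation_fanE; exists S' => //; apply: noncrossing_subset ncS.
- move=> C C' /triangulation_fanE[S ncS ->] /triangulation_fanE[S' ncS' ->].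
  rewrite set_coneI //; split; apply/face_set_cone => //.
    by exists (S :&: S')%SET => //; apply: subsetIl.
  by exists (S :&: S')%SET => //; apply: subsetIr.
Qed.

Lemma triangulation_fan_complete : complete_fan (triangulation_fan P delta alpha).
Proof.
apply/seteqP; split=> // x _; have [c [c0 ncc] <-] := combination_surj x.
(* The cone containing [x] is that of the support of its non-crossing weight. *)
exists (set_cone [set d | c d != 0]%SET).
  by apply/triangulation_fanE; exists [set d | c d != 0]%SET => // d e; rewrite !inE; apply: ncc.
by exists c; split => // d; rewrite inE negbK => /eqP.
Qed.

End Fan.

Theorem theorem5p1 (R : realType) (n : nat)
    (P : 'I_n.+3 -> 'rV[R]_2) (hP : convex_polygon P)
    (T0 : {set polygon_diagonal n.+3}) (hT0 : triangulation P T0)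
    (delta : n.-tuple (polygon_diagonal n.+3)) (hdelta : uniq delta)
    (hT0delta : T0 = [set d in delta]%SET)
    (V : vectType R) (alpha : n.-tuple V) (halpha : basis_of fullv alpha) :
  [/\ forall T : {set polygon_diagonal n.+3}, triangulation P T ->
        free (triangulation_generators P delta alpha T),
      simplicial_fan (triangulation_fan P delta alpha)
    & complete_fan (triangulation_fan P delta alpha)].
Proof.
have mT0 : maximal_noncrossing [set d in delta]%SET.
  by rewrite -hT0delta; apply: (maximal_triangulation T0 hP).1.
split.
- move=> T /(maximal_triangulation T hP)[ncT _].
  exact: generators_free.
- exact: triangulation_fan_simplicial.
- exact: triangulation_fan_complete.
Qed.
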